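(* Let $z>0$ and $b,c\in(0,1]$. Let $F_L=F_R=\beta(1,z)$ and $p(x)=cx+(1-b)(1-x)$ for $x\in[0,1]$, and let $X=\{X_n\}_{n\ge0}$ be the Markov chain on $[0,1]$ described in the context. Then $X$ is ergodic with stationary distribution $\beta(bz,cz)$.
   Context: The chain $X=\{X_n\}_{n\ge0}$ is defined by $X_0=x_0\in[0,1]$ and $$X_{n+1}=X_n-X_nL_{n+1}I_{n+1}+(1-X_n)R_{n+1}(1-I_{n+1}),\qquad n=0,1,\ldots,$$ where $I_{n+1}:=\mathbf{1}_{\{U_{n+1}<p(X_n)\}}$ ($\mathbf{1}_A$ is the indicator of the event $A$), and $\{L_n\}_{n\ge1}$, $\{R_n\}_{n\ge1}$, $\{U_n\}_{n\ge1}$ are independent sequences of i.i.d. random variables with $L_n\sim F_L$, $R_n\sim F_R$, and $U_n$ uniform on $[0,1]$. $\beta(a,b)$, $a,b>0$, denotes the beta distribution with density $x^{a-1}(1-x)^{b-1}/B(a,b)$, $0<x<1$, where $B(a,b)$ is the beta function. Ergodicity is meant in the usual sense for Harris chains: there is a unique stationary probability distribution $\Pi$ on $[0,1]$ and, for every starting point $x_0\in[0,1]$, the law of $X_n$ converges to $\Pi$ in total variation as $n\to\infty$. *)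

(* Defs.v *)
From HB Require Import structures.
From mathcomp Require Import all_boot all_order all_algebra.
From mathcomp Require Import all_classical all_reals all_analysis.
Set Implicit Arguments.
Unset Strict Implicit.
Unset Printing Implicit Defensive.
Import Order.TTheory GRing.Theory Num.Theory.
Import numFieldNormedType.Exports.
Local Open Scope classical_set_scope.
Local Open Scope ring_scope.

(* The library's beta_fun, beta_pdf and beta_prob only take parameters in nat;
   here the parameters are real. *)
Definition betaR_fun (R : realType) (a b : R) : R :=
  \int[@lebesgue_measure R]_(x in `]0, 1[%classic) (x `^ (a - 1) * (1 - x) `^ (b - 1)).

Definition betaR_pdf (R : realType) (a b x : R) : R :=
  if 0 < x < 1 then x `^ (a - 1) * (1 - x) `^ (b - 1) / betaR_fun a b else 0.

Definition has_beta_law (R : realType) (a b : R)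
    (mu : set (measurableTypeR R) -> \bar R) : Prop :=
  forall A : set (measurableTypeR R), measurable A ->
    mu A = (\int[@lebesgue_measure R]_(x in A) (betaR_pdf a b x)%:E)%E.

Definition has_uniform01_law (R : realType)
    (mu : set (measurableTypeR R) -> \bar R) : Prop :=
  forall A : set (measurableTypeR R), measurable A ->
    mu A = uniform_prob (@ltr01 R) A.

Definition mutually_independent (d : measure_display) (T : measurableType d)
    (R : realType) (P : probability T R) (I : eqType) (Y : I -> T -> R) : Prop :=
  forall (J : seq I) (B : I -> set (measurableTypeR R)), uniq J ->
    (forall i, measurable (B i)) ->
    P (\bigcap_(i in [set` J]) (Y i @^-1` B i)) =
      (\big[*%E/1]_(i <- J) P (Y i @^-1` B i))%E.

(* {L_n}, {R_n}, {U_n}, n >= 1, put together in a single family; its mutual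
   independence says both that the three sequences are independent of each
   other and that the terms of each of them are independent. *)
Definition noise_family (T V : Type) (L Rt U : nat -> T -> V)
    (i : nat + nat + nat) : T -> V :=
  match i with
  | inl (inl n) => L n.+1
  | inl (inr n) => Rt n.+1
  | inr n => U n.+1
  end.

Definition chain_step (R : realType) (p : R -> R) (x l r u : R) : R :=
  let i : R := if u < p x then 1 else 0 in
  x - x * l * i + (1 - x) * r * (1 - i).

(* The terms of index 0 of L, Rt and U are not used. *)
Fixpoint chain (R : realType) (T : Type) (p : R -> R) (L Rt U : nat -> T -> R)
    (x0 : R) (n : nat) (t : T) : R :=
  match n with
  | 0%N => x0
  | m.+1 => chain_step p (chain p L Rt U x0 m t) (L m.+1 t) (Rt m.+1 t) (U m.+1 t)
  end.

Definition tv_dist (R : realType)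
    (mu nu : set (measurableTypeR R) -> \bar R) : \bar R :=
  ereal_sup [set `|mu A - nu A|%E | A in [set A | measurable A]].

(* X x n t is the state at time n of the time-homogeneous chain started at x.
   [law_at P X x n] is the law of this state; for n = 1 it is the transition
   kernel of the chain at x. *)
Definition law_at (d : measure_display) (T : measurableType d) (R : realType)
    (P : probability T R) (X : R -> nat -> T -> R) (x : R) (n : nat)
    (A : set (measurableTypeR R)) : \bar R :=
  P (X x n @^-1` A).

Definition stationary01 (d : measure_display) (T : measurableType d)
    (R : realType) (P : probability T R) (X : R -> nat -> T -> R)
    (Pi : probability (measurableTypeR R) R) : Prop :=
  Pi `[0, 1]%classic = 1%E /\
  forall A : set (measurableTypeR R), measurable A ->
    (\int[Pi]_(x in `[0%R, 1%R]%classic) law_at P X x 1 A)%E = Pi A.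

Definition ergodic01_with (d : measure_display) (T : measurableType d)
    (R : realType) (P : probability T R) (X : R -> nat -> T -> R)
    (Pi : probability (measurableTypeR R) R) : Prop :=
  [/\ stationary01 P X Pi,
      forall Pi' : probability (measurableTypeR R) R, stationary01 P X Pi' ->
        forall A : set (measurableTypeR R), measurable A -> Pi' A = Pi A
    & forall x0 : R, 0 <= x0 <= 1 ->
        tv_dist (law_at P X x0 n) Pi @[n --> \oo] --> 0%E].

(* Main.v *)
Require Import Defs.
From HB Require Import structures.
From mathcomp Require Import all_boot all_order all_algebra.
From mathcomp Require Import all_classical all_reals all_analysis.
From mathcomp Require Import measurable_realfun ring lra.
Import Order.TTheory GRing.Theory Num.Theory.
Import numFieldNormedType.Exports.
Local Open Scope classical_set_scope.
Local Open Scope ring_scope.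
Set Implicit Arguments.
Unset Strict Implicit.
Unset Printing Implicit Defensive.

(** From a state x the chain jumps to x (1 - L) with probability
    p(x) = c x + (1 - b) (1 - x) and to x + (1 - x) R otherwise, where 1 - L and
    1 - R have distribution function s^z on [0, 1].

    Stationarity.  A law on [0, 1] is stationary as soon as, for every level y
    in ]0, 1[, one step carries as much mass downwards across y as upwards
    (rays determine a measure, [eq_measure_rays]).  For a law with density f the
    two fluxes are the integrals of p(x) (y/x)^z f(x) over x > y and of
    (1 - p(x)) ((1 - y)/(1 - x))^z f(x) over x < y.  For the beta density with
    parameters b z and c z both integrands are, up to constants, derivatives of
    functions x^a (1 - x)^e ([is_derive_beta_primitive]), because the linear
    factor in such a derivative is proportional to p, respectively to 1 - p.
    Both fluxes equal y^(b z) (1 - y)^(c z) / (z B), where B is the beta integral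
    ([flux_down], [flux_up], [beta_stationary]).

    Ergodicity.  The laws of u (1 - L), for u in [1/4, 1], have a common
    component: conditioned to be below w <= u, the variable u (1 - L) is
    distributed as w (1 - L) ([beta1_self_similar]).  Every point of [0, 1]
    reaches [1/4, 1] in one step with a probability bounded below ([law_reach]),
    and from there a downward move has probability at least c/4.  Hence the
    two-step kernel dominates a fixed multiple eps of a fixed probability nu
    ([doeblin_minorization]).  It follows that two steps of the Markov operator
    shrink the oscillation of a function on [0, 1] by the factor 1 - eps
    ([transition2_contracts]); since the integral of the probability of being in
    A at time n against a stationary law is the mass of A, that mass and the law
    of X_n differ by at most (1 - eps)^(n/2), uniformly in A and in the starting
    point ([doeblin_ergodic]).

    The passage from the noise to a Markov operator is [markov_property]: X_n is
    independent of all the noise of later times, so the noise of the next step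
    can be integrated out with X_n fixed ([integrate_out]). *)

(** * Measures on the line and on products *)

(** Open lower rays are stable under intersection and generate the Borel sets. *)
Lemma eq_measure_rays (R : realType)
    (m1 m2 : {measure set R -> \bar R}) :
  (m1 setT < +oo)%E -> (forall y : R, m1 `]-oo, y[%classic = m2 `]-oo, y[%classic) ->
  forall A : set R, measurable A -> m1 A = m2 A.
Proof.
move=> m1T m12 A mA; apply: (@measure_unique _ R R (@RGenInftyO.G R)
  (fun n => `]-oo, n%:R[%classic) _ _ _ _ m1 m2 _ _ A mA).
- exact: RGenInftyO.measurableE.
- move=> _ _ [x ->] [y ->]; exists (Num.min x y).
  by apply/seteqP; split => t /=; rewrite !in_itv/= lt_min => /andP.
- by move=> n; exists n%:R.
- apply/seteqP; split => // x _; exists (Num.bound `|x|) => //=.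
  by rewrite in_itv/= (le_lt_trans (ler_norm x))// archi_boundP.
- by move=> _ [x ->].
- move=> n; apply: le_lt_trans m1T; apply: le_measure; rewrite ?inE//.
Qed.

(** Measurable rectangles are stable under intersection and generate the product
    sigma-algebra. *)
Lemma eq_finite_measure_rect (R : realType) d1 d2 (T1 : measurableType d1)
    (T2 : measurableType d2) (m1 m2 : {measure set (T1 * T2) -> \bar R}) :
  (m1 setT < +oo)%E ->
  (forall A B, measurable A -> measurable B -> m1 (A `*` B) = m2 (A `*` B)) ->
  forall C, measurable C -> m1 C = m2 C.
Proof.
move=> m1T m12.
pose G : set (set (T1 * T2)) :=
  [set A `*` B | A in measurable & B in measurable].
apply: (measure_unique G (fun=> setT)).
- exact: measurable_prod_measurableType.
- move=> _ _ [A1 mA1 [B1 mB1 <-]] [A2 mA2 [B2 mB2 <-]].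
  exists (A1 `&` A2); first exact: measurableI.
  exists (B1 `&` B2); first exact: measurableI.
  by rewrite setXI.
- by move=> _; exists setT => //; exists setT => //; rewrite setXTT.
- by rewrite bigcup_const.
- by move=> _ [A mA [B mB <-]]; exact: m12.
- by [].
Qed.

(** * Integrals of beta densities *)

Lemma is_derive_continuous (R : realType) (f : R -> R) (x df : R) :
  is_derive x 1 f df -> {for x, continuous f}.
Proof.
by move=> [dfx _]; apply: differentiable_continuous; exact/derivable1_diffP.
Qed.

(** The integrand may be unbounded near both endpoints, as happens for a beta
    density whose parameters are below 1.  On closed subintervals the usual
    theorem applies, and nonnegativity allows a monotone passage to the limit. *)
Lemma ge0_FTC_oo (R : realType) (f F : R -> R) (a b : R) : a < b ->
  {in `]a, b[, continuous f} -> {in `]a, b[, forall x, 0 <= f x} ->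
  (forall x, a < x < b -> is_derive x 1 F (f x)) ->
  F x @[x --> a^'+] --> F a -> F x @[x --> b^'-] --> F b ->
  (\int[@lebesgue_measure R]_(x in `]a, b[) (f x)%:E = (F b - F a)%:E)%E.
Proof.
move=> ab cf f0 dF Fa Fb.
(* Dividing by at least 3 keeps a + e n < b - e n for every n. *)
pose e n : R := (b - a) / n.+3%:R.
have e0 n : 0 < e n by rewrite divr_gt0// subr_gt0.
have e3 n : e n <= (b - a) / 3.
  by rewrite /e ler_pM2l ?subr_gt0// lef_pV2 ?posrE// ler_nat.
have abn n : a + e n < b - e n by have := e3 n; lra.
have ebound n (x : R) : a + e n <= x <= b - e n -> a < x < b.
  by have := e0 n; lra.
pose I n : set R := `[a + e n, b - e n]%classic.
have UI : `]a, b[%classic = \bigcup_n I n.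
  apply/seteqP; split => x /=; last first.
    by case=> n _; rewrite /I/= !in_itv/= => /ebound.
  rewrite in_itv/= => /andP[ax xb].
  have m0 : 0 < Num.min (x - a) (b - x) by rewrite lt_min !subr_gt0 ax xb.
  have r0 : 0 <= (b - a) / Num.min (x - a) (b - x).
    by rewrite divr_ge0// ltW// subr_gt0.
  exists (Num.bound ((b - a) / Num.min (x - a) (b - x))) => //.
  set n := Num.bound _.
  have : (b - a) / Num.min (x - a) (b - x) < n.+3%:R.
    by rewrite (lt_le_trans (archi_boundP r0))// ler_nat -/n -addn3 leq_addr.
  rewrite ltr_pdivrMr// mulrC -ltr_pdivrMr// -/(e n) lt_min /I/= in_itv/=.
  lra.
have ndI : nondecreasing_seq I.
  move=> m n mn; apply/subsetPset => x; rewrite /I/= !in_itv/=.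
  suff : e n <= e m by lra.
  rewrite /e ler_pM2l ?subr_gt0// lef_pV2 ?posrE// ler_nat !ltnS//.
have cfI n : {within I n, continuous f}.
  apply: continuous_in_subspaceT => x; rewrite inE /I/= in_itv/= => /ebound xab.
  by apply: cf; rewrite in_itv.
have mfI n : measurable_fun (I n) (EFin \o f).
  apply/measurable_EFinP; apply: subspace_continuous_measurable_fun => //.
  exact: measurable_itv.
transitivity (limn (fun n => \int[@lebesgue_measure R]_(x in I n) (f x)%:E)%E).
  rewrite UI; apply/esym/cvg_lim => //; apply: ge0_nondecreasing_set_cvg_integral => //.
  - by move=> n; exact: measurable_itv.
  - move=> n x; rewrite /I/= in_itv/= => /ebound xab.
    by rewrite lee_fin; apply: f0; rewrite in_itv.
have IE n : (\int[@lebesgue_measure R]_(x in I n) (f x)%:E)%E =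
    (F (b - e n) - F (a + e n))%:E.
  rewrite EFinB; apply: continuous_FTC2 => //.
  - exact: (cfI n).
  - have cF x : a + e n <= x <= b - e n -> {for x, continuous F}.
      by move=> /ebound/dF; exact: is_derive_continuous.
    split => [x| |].
    + rewrite in_itv/= => xab; suff [] : is_derive x 1 F (f x) by [].
      by apply: dF; apply: (ebound n); lra.
    + apply: cvg_at_right_filter; apply: cF; have := abn n; lra.
    + apply: cvg_at_left_filter; apply: cF; have := abn n; lra.
  - move=> x; rewrite in_itv/= => xab.
    rewrite derive1E; suff [] : is_derive x 1 F (f x) by [].
    by apply: dF; apply: (ebound n); lra.
under eq_fun do rewrite IE.
have ecvg : e n @[n --> \oo] --> (0 : R).
  have -> : (0:R) = (b - a) * 0 by rewrite mulr0.
  apply: cvgMr => /=.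
  have : (fun n => @harmonic R n.+2) @ \oo --> (0 : R).
    rewrite (cvg_shiftS (fun n => @harmonic R n.+1)).
    rewrite (cvg_shiftS (@harmonic R)); exact: cvg_harmonic.
  exact.
apply/cvg_lim => //; apply: cvg_EFin; first exact: nearW.
apply: cvgB.
- move/cvg_at_leftP : Fb; apply; split => [n|].
    by rewrite ltrBlDr ltrDl.
  rewrite -[X in _ --> X]subr0; apply: cvgB => //; exact: cvg_cst.
- move/cvg_at_rightP : Fa; apply; split => [n|].
    by rewrite ltrDl.
  rewrite -[X in _ --> X]addr0; apply: cvgD => //; exact: cvg_cst.
Qed.

Lemma is_derive_onem_powR (R : realType) (b x : R) : x < 1 ->
  is_derive x 1 (fun x : R => (1 - x) `^ b) (- (b * (1 - x) `^ (b - 1))).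
Proof.
move=> x1.
have dg : is_derive x 1 (fun x : R => 1 - x) (-1).
  have -> : -1 = 0 - 1 :> R by rewrite sub0r.
  exact: is_deriveB.
have df : is_derive (1 - x) 1 (@powR R ^~ b) (b * (1 - x) `^ (b - 1)).
  by apply: is_derive1_powR; rewrite subr_gt0.
have := @is_derive1_comp _ (@powR R ^~ b) (fun x : R => 1 - x) x _ _ df dg.
by rewrite mulrN1.
Qed.

(** Every beta integral of the stationarity proof is computed with this primitive:
    with (a, b) = (- (1 - b') z, c z) the linear factor is - z p(x), and with
    (a, b) = (b' z, - (1 - c) z) it is z (1 - p(x)), for the move probability
    p(x) = c x + (1 - b') (1 - x). *)
Lemma is_derive_beta_primitive (R : realType) (a b x : R) : 0 < x < 1 ->
  is_derive x 1 (fun x : R => x `^ a * (1 - x) `^ b)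
    (x `^ (a - 1) * (1 - x) `^ (b - 1) * (a * (1 - x) - b * x)).
Proof.
move=> /andP[x0 x1].
have dg := is_derive_onem_powR b x1.
have df := is_derive1_powR a x0.
apply: (is_derive_eq (@is_deriveM _ _ _ _ _ _ _ _ df dg)).
have xE : x `^ a = x * x `^ (a - 1).
  by rewrite powRB ?(lt0r_neq0 x0) ?implybT// powRr1 ?ltW// mulrC divfK// lt0r_neq0.
have yE : (1 - x) `^ b = (1 - x) * (1 - x) `^ (b - 1).
  have y0 : 0 < 1 - x by rewrite subr_gt0.
  by rewrite powRB ?(lt0r_neq0 y0) ?implybT// powRr1 ?ltW// mulrC divfK// lt0r_neq0.
rewrite xE yE /GRing.scale/=; ring.
Qed.

Lemma onem_powR_cvg_left1 (R : realType) (b : R) : 0 < b ->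
  (1 - x) `^ b @[x --> (1:R)^'-] --> (0 : R).
Proof.
move=> b0; apply/cvg_at_leftP => u [u1 ucvg].
have /cvg_at_rightP := @powR_cvg0 R b b0; apply; split.
  by move=> n; rewrite subr_gt0.
by rewrite -(subrr 1); apply: cvgB => //; exact: cvg_cst.
Qed.

Lemma beta_density_continuous (R : realType) (a b x : R) : 0 < x < 1 ->
  {for x, continuous (fun x : R => x `^ a * (1 - x) `^ b)}.
Proof.
by move=> /(is_derive_beta_primitive a b); exact: is_derive_continuous.
Qed.

(** The signs of a and b make the integrand nonnegative, and 0 < b makes the
    primitive vanish at 1. *)
Lemma integral_beta_primitive_right (R : realType) (a b y : R) :
  a <= 0 -> 0 < b -> 0 < y < 1 ->
  (\int[@lebesgue_measure R]_(x in `]y, 1%R[)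
    (x `^ (a - 1) * (1 - x) `^ (b - 1) * (b * x - a * (1 - x)))%:E =
   (y `^ a * (1 - y) `^ b)%:E)%E.
Proof.
move=> a0 b0 y01.
pose F (x : R) : R := - (x `^ a * (1 - x) `^ b).
have dF x : y < x < 1 -> is_derive x 1 F
    (x `^ (a - 1) * (1 - x) `^ (b - 1) * (b * x - a * (1 - x))).
  move=> yx1; have /(is_derive_beta_primitive a b) H : 0 < x < 1 by lra.
  apply: (is_derive_eq (@is_deriveN _ _ _ _ _ _ _ H)); ring.
have -> : y `^ a * (1 - y) `^ b = F 1 - F y.
  by rewrite /F subrr powR0 ?gt_eqF// mulr0 oppr0 sub0r opprK.
apply: (@ge0_FTC_oo R _ F) => //.
- by lra.
- move=> x; rewrite in_itv/= => yx1; apply: cvgM.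
    by apply: beta_density_continuous; lra.
  apply: cvgB; first by apply: cvgM; [exact: cvg_cst|exact: cvg_id].
  by apply: cvgM; [exact: cvg_cst|apply: cvgB; [exact: cvg_cst|exact: cvg_id]].
- move=> x; rewrite in_itv/= => yx1.
  rewrite mulr_ge0 ?mulr_ge0 ?powR_ge0// subr_ge0.
  have : 0 <= b * x by rewrite mulr_ge0; lra.
  have : 0 <= - a * (1 - x) by rewrite mulr_ge0; lra.
  lra.
- apply: cvg_at_right_filter; apply: cvgN; exact: beta_density_continuous.
- rewrite /F subrr powR0 ?gt_eqF// mulr0; apply: cvgN.
  rewrite -[X in _ --> X](mulr0 (1 `^ a)); apply: cvgM; last exact: onem_powR_cvg_left1.
  apply: cvg_at_left_filter.
  exact: (is_derive_continuous (is_derive1_powR a (@ltr01 R))).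
Qed.

(** The mirror image of the previous integral, with a primitive vanishing at 0. *)
Lemma integral_beta_primitive_left (R : realType) (a b y : R) :
  0 < a -> b <= 0 -> 0 < y < 1 ->
  (\int[@lebesgue_measure R]_(x in `]0%R, y[)
    (x `^ (a - 1) * (1 - x) `^ (b - 1) * (a * (1 - x) - b * x))%:E =
   (y `^ a * (1 - y) `^ b)%:E)%E.
Proof.
move=> a0 b0 y01.
pose F (x : R) : R := x `^ a * (1 - x) `^ b.
have dF x : 0 < x < y -> is_derive x 1 F
    (x `^ (a - 1) * (1 - x) `^ (b - 1) * (a * (1 - x) - b * x)).
  by move=> yx1; apply: is_derive_beta_primitive; lra.
have -> : y `^ a * (1 - y) `^ b = F y - F 0.
  by rewrite /F powR0 ?gt_eqF// mul0r subr0.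
apply: (@ge0_FTC_oo R _ F) => //.
- by lra.
- move=> x; rewrite in_itv/= => yx1; apply: cvgM.
    by apply: beta_density_continuous; lra.
  apply: cvgB; last by apply: cvgM; [exact: cvg_cst|exact: cvg_id].
  by apply: cvgM; [exact: cvg_cst|apply: cvgB; [exact: cvg_cst|exact: cvg_id]].
- move=> x; rewrite in_itv/= => yx1.
  rewrite mulr_ge0 ?mulr_ge0 ?powR_ge0// subr_ge0.
  have : 0 <= a * (1 - x) by rewrite mulr_ge0; lra.
  have : 0 <= - b * x by rewrite mulr_ge0; lra.
  lra.
- rewrite /F powR0 ?gt_eqF// mul0r.
  rewrite -[X in _ --> X](mul0r ((1 - 0) `^ b)); apply: cvgM; first exact: powR_cvg0.
  apply: cvg_at_right_filter.
  exact: (is_derive_continuous (is_derive_onem_powR b (@ltr01 R))).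
- by apply: cvg_at_left_filter; exact: beta_density_continuous.
Qed.

Lemma integral_onem_powR (R : realType) (z s : R) : 0 < z -> s <= 1 ->
  (\int[@lebesgue_measure R]_(x in `]s, 1%R[) ((1 - x) `^ (z - 1))%:E =
   ((1 - s) `^ z / z)%:E)%E.
Proof.
move=> z0; rewrite le_eqVlt => /predU1P[->|s1].
  by rewrite set_itv_ge ?bnd_simp ?ltxx// integral_set0 subrr powR0 ?gt_eqF// mul0r.
pose F (x : R) : R := - z^-1 * (1 - x) `^ z.
have dF (x : R) : x < 1 -> is_derive x 1 F ((1 - x) `^ (z - 1)).
  move=> x1; have dg := is_derive_onem_powR z x1.
  apply: (is_derive_eq (@is_deriveM _ _ _ _ _ _ _ _ (is_derive_cst (- z^-1) x 1) dg)).
  by rewrite /GRing.scale/= mulr0 addr0 mulrNN mulrA mulVf ?mul1r// gt_eqF.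
have cF (x : R) : x < 1 -> {for x, continuous F}.
  by move=> /dF; exact: is_derive_continuous.
have -> : (1 - s) `^ z / z = F 1 - F s.
  by rewrite /F subrr powR0 ?gt_eqF// mulr0 sub0r mulNr opprK mulrC.
apply: (@ge0_FTC_oo R _ F) => //.
- move=> x; rewrite in_itv/= => /andP[_ x1].
  exact: (is_derive_continuous (is_derive_onem_powR (z - 1) x1)).
- by move=> x _; exact: powR_ge0.
- by move=> x /andP[_]; exact: dF.
- by apply: cvg_at_right_filter; exact: cF.
- rewrite {2}/F subrr powR0 ?gt_eqF// mulr0.
  rewrite -[X in _ --> X](mulr0 (- z^-1)); apply: cvgM; first exact: cvg_cst.
  exact: onem_powR_cvg_left1.
Qed.

Section beta_law.
Context {R : realType}.
Implicit Types (a b x : R).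
Local Notation leb := (@lebesgue_measure R).

Definition beta_weight a b x : R := x `^ (a - 1) * (1 - x) `^ (b - 1).

Lemma beta_weight_ge0 a b x : 0 <= beta_weight a b x.
Proof. by rewrite mulr_ge0 ?powR_ge0. Qed.

Lemma measurable_beta_weight a b : measurable_fun [set: R] (beta_weight a b).
Proof.
apply: measurable_funM; first exact: measurable_powR.
apply: (measurableT_comp (measurable_powR (b - 1))).
exact: measurable_funB.
Qed.

(** An integrable function with the singularities of the beta density at both
    endpoints; its primitive is x^a - (1 - x)^b. *)
Let integral_endpoint_singularities a b : 0 < a -> 0 < b ->
  (\int[leb]_(x in `]0%R, 1%R[)
     (a * x `^ (a - 1) + b * (1 - x) `^ (b - 1))%:E = 2%:E)%E.
Proof.
move=> a0 b0; pose F (x : R) : R := x `^ a - (1 - x) `^ b.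
have dF (x : R) : 0 < x < 1 -> is_derive x 1 F
    (a * x `^ (a - 1) + b * (1 - x) `^ (b - 1)).
  move=> /andP[x0 x1].
  apply: (is_derive_eq (@is_deriveB _ _ _ _ _ _ _ _ _
    (is_derive1_powR a x0) (is_derive_onem_powR b x1))).
  by rewrite opprK.
have -> : 2 = F 1 - F 0.
  by rewrite /F subrr subr0 !powR0 ?gt_eqF// !powR1 subr0 sub0r opprK.
apply: (@ge0_FTC_oo R _ F) => //.
- move=> x; rewrite in_itv/= => /andP[x0 x1].
  apply: cvgD; (apply: cvgM; first exact: cvg_cst).
    exact: (is_derive_continuous (is_derive1_powR (a - 1) x0)).
  exact: (is_derive_continuous (is_derive_onem_powR (b - 1) x1)).
- by move=> x _; rewrite addr_ge0// mulr_ge0 ?powR_ge0// ltW.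
- rewrite {2}/F powR0 ?gt_eqF//; apply: cvgB; first exact: powR_cvg0.
  apply: cvg_at_right_filter.
  exact: (is_derive_continuous (is_derive_onem_powR b (@ltr01 R))).
- rewrite {2}/F subrr (@powR0 _ b) ?gt_eqF//; apply: cvgB.
    apply: cvg_at_left_filter.
    exact: (is_derive_continuous (is_derive1_powR a (@ltr01 R))).
  exact: onem_powR_cvg_left1.
Qed.

(** x^(b - 1) = x^b / x, and both factors are controlled on [1/2, 1]. *)
Let powRB1_bounds b x : 0 < b -> 2^-1 <= x <= 1 ->
  2^-1 `^ b <= x `^ (b - 1) <= 2.
Proof.
move=> b0 /andP[x2 x1]; have x0 : 0 < x by lra.
have -> : x `^ (b - 1) = x `^ b / x.
  by rewrite powRB ?(lt0r_neq0 x0) ?implybT// powRr1 ?ltW.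
have lex : 2^-1 `^ b <= x `^ b by apply: ge0_ler_powR; rewrite ?nnegrE; lra.
have xle : x `^ b <= 1.
  have <- : 1 `^ b = 1 :> R by rewrite powR1.
  by apply: ge0_ler_powR; rewrite ?nnegrE; lra.
rewrite ler_pdivrMr// ler_pdivlMr//; apply/andP; split; last by lra.
apply: le_trans lex; rewrite ler_piMr ?powR_ge0//.
Qed.

Let beta_weight_le a b x : 0 < a -> 0 < b -> 0 < x < 1 ->
  beta_weight a b x <=
  2 * (a^-1 + b^-1) * (a * x `^ (a - 1) + b * (1 - x) `^ (b - 1)).
Proof.
move=> a0 b0 x01; rewrite /beta_weight.
set u := x `^ _; set v := (1 - x) `^ _.
have u0 : 0 <= u by exact: powR_ge0.
have v0 : 0 <= v by exact: powR_ge0.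
have aV : 0 <= a^-1 by rewrite invr_ge0 ltW.
have bV : 0 <= b^-1 by rewrite invr_ge0 ltW.
have -> : 2 * (a^-1 + b^-1) * (a * u + b * v) =
    2 * u + 2 * v + 2 * (b^-1 * a * u + a^-1 * b * v).
  have ? : a != 0 by exact: lt0r_neq0.
  have ? : b != 0 by exact: lt0r_neq0.
  by field; apply/andP.
have r0 : 0 <= b^-1 * a * u + a^-1 * b * v.
  by rewrite addr_ge0// mulr_ge0// mulr_ge0// ltW.
have [x2|x2] := leP x 2^-1.
  have /andP[_ v2] : 2^-1 `^ b <= v <= 2 by apply: powRB1_bounds => //; lra.
  have : u * v <= u * 2 by rewrite ler_wpM2l.
  lra.
have /andP[_ u2] : 2^-1 `^ a <= u <= 2 by apply: powRB1_bounds => //; lra.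
have : u * v <= 2 * v by rewrite ler_wpM2r.
lra.
Qed.

Let measurable_EFin_beta_weight a b D :
  measurable_fun D (fun x => (beta_weight a b x)%:E).
Proof.
by apply/measurable_EFinP; apply: measurable_funTS; exact: measurable_beta_weight.
Qed.

(** The real-valued integral that defines [betaR_fun] would be 0 if the extended
    one were infinite; the majorant of [beta_weight_le] excludes this. *)
Lemma EFin_betaR_fun a b : 0 < a -> 0 < b ->
  (\int[leb]_(x in `]0%R, 1%R[) (beta_weight a b x)%:E = (betaR_fun a b)%:E)%E.
Proof.
move=> a0 b0; rewrite /betaR_fun /Rintegral fineK// ge0_fin_numE; last first.
  by apply: integral_ge0 => x _; rewrite lee_fin beta_weight_ge0.
pose g x := a * x `^ (a - 1) + b * (1 - x) `^ (b - 1).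
have mg : measurable_fun setT g.
  apply: measurable_funD; apply: measurable_funM => //.
  apply: (measurableT_comp (measurable_powR (b - 1))).
  exact: measurable_funB.
have g0 x : 0 <= g x by rewrite addr_ge0// mulr_ge0 ?powR_ge0// ltW.
apply: (@le_lt_trans _ _ (\int[leb]_(x in `]0%R, 1%R[)
    ((2 * (a^-1 + b^-1))%:E * (g x)%:E))%E).
  apply: ge0_le_integral => //=.
  - by move=> x _; rewrite lee_fin beta_weight_ge0.
  - exact: measurable_EFin_beta_weight.
  - apply: measurable_funTS; apply: measurable_funeM.
    by apply/measurable_EFinP.
  - by move=> x; rewrite in_itv/= => x01; rewrite -EFinM lee_fin beta_weight_le.
rewrite ge0_integralZl//.
- by rewrite integral_endpoint_singularities// -EFinM ltry.
- by apply: measurable_funTS; exact/measurable_EFinP.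
- by move=> x _; rewrite lee_fin.
- by rewrite lee_fin mulr_ge0// addr_ge0// invr_ge0 ltW.
Qed.

(** On ]0, 1/2[ the weight is at least a constant multiple of x^(a - 1), whose
    integral is explicit. *)
Lemma betaR_fun_gt0 a b : 0 < a -> 0 < b -> 0 < betaR_fun a b.
Proof.
move=> a0 b0; rewrite -lte_fin -EFin_betaR_fun//.
have h01 : 0 < (2^-1 : R) < 1 by apply/andP; split; lra.
have := integral_beta_primitive_left a0 (lexx 0) h01.
rewrite powRr0 mulr1 => H.
apply: (@lt_le_trans _ _ (\int[leb]_(x in `]0%R, 2^-1%R[)
   ((2^-1 `^ b / a / 2)%:E * (x `^ (a - 1) * (1 - x) `^ (0 - 1) *
      (a * (1 - x) - 0 * x))%:E))%E).
  rewrite ge0_integralZl//=.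
  - rewrite H -EFinM lte_fin !(mulr_gt0, invr_gt0, powR_gt0)//.
  - apply/measurable_EFinP; apply: measurable_funTS.
    apply: measurable_funM; first exact: (measurable_beta_weight a 0).
    apply: measurable_funB; last exact: measurable_funM.
    by apply: measurable_funM => //; exact: measurable_funB.
  - move=> x; rewrite in_itv/= => x01.
    by rewrite lee_fin mul0r subr0 mulr_ge0 ?mulr_ge0 ?powR_ge0//; lra.
  - by rewrite lee_fin divr_ge0// divr_ge0 ?powR_ge0// ltW.
apply: (@le_trans _ _ (\int[leb]_(x in `]0%R, 2^-1%R[) (beta_weight a b x)%:E)%E).
  apply: ge0_le_integral => //=.
  - move=> x; rewrite in_itv/= => x01; rewrite -EFinM.
    rewrite lee_fin mul0r subr0 mulr_ge0 ?divr_ge0 ?powR_ge0 ?(ltW a0)//.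
    by rewrite mulr_ge0 ?mulr_ge0 ?powR_ge0//; lra.
  - apply: measurable_funeM; apply/measurable_EFinP; apply: measurable_funTS.
    apply: measurable_funM; first exact: (measurable_beta_weight a 0).
    apply: measurable_funB; last exact: measurable_funM.
    by apply: measurable_funM => //; exact: measurable_funB.
  - exact: measurable_EFin_beta_weight.
  - move=> x; rewrite in_itv/= => x01; rewrite -EFinM lee_fin.
    rewrite sub0r powR_inv1; last lra.
    have xn0 : 1 - x != 0 by apply: lt0r_neq0; lra.
    have an0 : a != 0 by exact: lt0r_neq0.
    have /andP[lb _] : 2^-1 `^ b <= (1 - x) `^ (b - 1) <= 2.
      by apply: powRB1_bounds => //; lra.
    rewrite /beta_weight.
    have -> : 2^-1 `^ b / a / 2 *
      (x `^ (a - 1) * (1 - x)^-1 * (a * (1 - x) - 0 * x)) =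
      x `^ (a - 1) * (2^-1 `^ b / 2) by field; apply/andP.
    rewrite ler_wpM2l ?powR_ge0//; have := powR_ge0 2^-1 b; lra.
apply: ge0_subset_integral => //=.
- exact: measurable_EFin_beta_weight.
- by move=> x _; rewrite lee_fin beta_weight_ge0.
- by move=> x /=; rewrite !in_itv/=; lra.
Qed.

Lemma betaR_pdf_restrict a b (A : set R) :
  (\int[leb]_(x in A) (betaR_pdf a b x)%:E =
   \int[leb]_(x in A `&` `]0%R, 1%R[) (beta_weight a b x / betaR_fun a b)%:E)%E.
Proof.
rewrite [RHS]integral_mkcondr; apply: eq_integral => x _.
rewrite patchE /betaR_pdf mem_setE in_itv/=.
by case: ifP.
Qed.

Lemma betaR_pdf_ge0 a b x : 0 < a -> 0 < b -> 0 <= betaR_pdf a b x.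
Proof.
move=> a0 b0; rewrite /betaR_pdf; case: ifPn => // _.
by rewrite divr_ge0 ?beta_weight_ge0// ltW// betaR_fun_gt0.
Qed.

Lemma measurable_betaR_pdf a b : measurable_fun [set: R] (betaR_pdf a b).
Proof.
rewrite /betaR_pdf; apply: measurable_fun_if => //=.
- by apply: measurable_and => //; exact: measurable_fun_ltr.
- apply: measurable_funTS; apply: measurable_funM => //.
  exact: measurable_beta_weight.
Qed.

End beta_law.

(** * Beta laws *)

Section density.
Local Open Scope ereal_scope.
Context d (T : measurableType d) (R : realType).
Variables (mu : {sigma_finite_measure set T -> \bar R})
          (nu : {finite_measure set T -> \bar R}) (g : T -> R).
Hypothesis mg : measurable_fun setT g.
Hypothesis nuE : forall A, measurable A -> nu A = \int[mu]_(x in A) (g x)%:E.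

(** The density coincides almost everywhere with the Radon-Nikodym derivative,
    for which the change of variables is known. *)
Lemma ge0_integral_density D (f : T -> \bar R) : measurable D ->
  measurable_fun setT f -> (forall x, 0 <= f x) ->
  \int[nu]_(x in D) f x = \int[mu]_(x in D) (f x * (g x)%:E).
Proof.
move=> mD mf f0.
have numu : nu `<< mu.
  apply/null_content_dominatesP => A mA muA0; rewrite nuE//.
  by apply: null_set_integral => //; apply/measurable_EFinP/measurable_funTS.
have mRN := measurable_int _ (Radon_Nikodym_SigmaFinite.f_integrable numu).
rewrite -(Radon_Nikodym_SigmaFinite.change_of_variables numu)//; last first.
  exact: measurable_funTS.
apply: ae_eq_integral => //.
- by apply: emeasurable_funM; exact: measurable_funTS.
- apply: emeasurable_funM; first exact: measurable_funTS.
  by apply/measurable_EFinP/measurable_funTS.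
- apply: ae_eqe_mul2l; apply: integral_ae_eq => //.
  + exact: integrableS (Radon_Nikodym_SigmaFinite.f_integrable numu).
  + by apply/measurable_EFinP/measurable_funTS.
  + by move=> E ED mE; rewrite -Radon_Nikodym_SigmaFinite.f_integral// nuE.
Qed.

End density.

Section beta_prob.
Context {R : realType}.
Variables (a b : R).
Hypotheses (a0 : 0 < a) (b0 : 0 < b).
Local Notation leb := (@lebesgue_measure R).

(** The positivity proofs are arguments so that the structure of a probability
    can be attached to this constant. *)
Definition betaR_measure of (0 < a) & (0 < b) : set (measurableTypeR R) -> \bar R :=
  fun A => (\int[leb]_(x in A) (betaR_pdf a b x)%:E)%E.

Local Notation mu := (betaR_measure a0 b0).

Let betaR_measure0 : mu set0 = 0%E.
Proof. by rewrite /betaR_measure integral_set0. Qed.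

Let betaR_measure_ge0 A : (0 <= mu A)%E.
Proof. by apply: integral_ge0 => x _; rewrite lee_fin betaR_pdf_ge0. Qed.

Let betaR_measure_sigma_additive : semi_sigma_additive mu.
Proof.
move=> F mF tF mUF; rewrite /betaR_measure; apply: cvg_toP.
  apply: ereal_nondecreasing_is_cvgn => m n mn.
  apply: lee_sum_nneg_natr => // k _ _; apply: integral_ge0 => x _.
  by rewrite lee_fin betaR_pdf_ge0.
rewrite ge0_integral_bigcup//=.
- by apply/measurable_EFinP/measurable_funTS; exact: measurable_betaR_pdf.
- by move=> x _; rewrite lee_fin betaR_pdf_ge0.
Qed.

HB.instance Definition _ := isMeasure.Build _ _ _ mu
  betaR_measure0 betaR_measure_ge0 betaR_measure_sigma_additive.

Let betaR_measure_setT : mu setT = 1%E.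
Proof.
rewrite /betaR_measure betaR_pdf_restrict setTI.
under eq_integral do rewrite EFinM.
rewrite ge0_integralZr//=.
- by rewrite EFin_betaR_fun// -EFinM divff// lt0r_neq0// betaR_fun_gt0.
- by apply/measurable_EFinP/measurable_funTS; exact: measurable_beta_weight.
- by move=> x _; rewrite lee_fin beta_weight_ge0.
- by rewrite lee_fin invr_ge0 ltW// betaR_fun_gt0.
Qed.

HB.instance Definition _ := Measure_isProbability.Build _ _ _ mu betaR_measure_setT.

Lemma exists_beta_law :
  exists Pi : probability (measurableTypeR R) R, has_beta_law a b Pi.
Proof. by exists mu. Qed.

Lemma ge0_integral_beta_law (Pi : probability (measurableTypeR R) R) D
    (f : R -> \bar R) : has_beta_law a b Pi -> measurable D ->
  measurable_fun setT f -> (forall x, 0 <= f x)%E ->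
  (\int[Pi]_(x in D) f x = \int[leb]_(x in D `&` `]0%R, 1%R[)
    (f x * (beta_weight a b x / betaR_fun a b)%:E))%E.
Proof.
move=> PiE mD mf f0.
rewrite (@ge0_integral_density _ _ _ leb Pi (betaR_pdf a b))//.
- rewrite [RHS]integral_mkcondr; apply: eq_integral => x _.
  rewrite patchE /betaR_pdf mem_setE in_itv/=.
  by case: ifP; rewrite ?mule0.
- exact: measurable_betaR_pdf.
Qed.

Lemma beta_law_itv01 (Pi : probability (measurableTypeR R) R) :
  has_beta_law a b Pi -> Pi `]0, 1[%classic = 1%E.
Proof.
move=> PiE; rewrite -(probability_setT Pi) !PiE// !betaR_pdf_restrict.
by rewrite setIid setTI.
Qed.

End beta_prob.

(** The boolean tells whether the ray contains its endpoint. *)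
Lemma beta1_tail (R : realType) (z s : R) (i : bool)
    (mu : set (measurableTypeR R) -> \bar R) :
  has_beta_law 1 z mu -> 0 < z -> 0 <= s <= 1 ->
  mu [set` Interval (BSide i s) +oo%O] = ((1 - s) `^ z)%:E.
Proof.
move=> muE z0 /andP[s0 s1].
have wE (x : R) : beta_weight 1 z x = (1 - x) `^ (z - 1).
  by rewrite /beta_weight subrr powRr0 mul1r.
have BE : betaR_fun 1 z = z^-1.
  apply: EFin_inj; rewrite -EFin_betaR_fun//.
  under eq_integral do rewrite wE.
  by rewrite integral_onem_powR// subr0 powR1 mul1r.
rewrite muE; last exact: measurable_itv.
rewrite betaR_pdf_restrict.
under eq_integral do rewrite wE BE invrK EFinM.
pose g (x : R) : \bar R := (((1 - x) `^ (z - 1))%:E * z%:E)%E.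
have mg : measurable_fun setT g.
  apply: emeasurable_funM => //; apply/measurable_EFinP.
  apply: (measurableT_comp (measurable_powR (z - 1))).
  exact: measurable_funB.
(* The endpoint of the ray is negligible; for s = 0 it lies outside ]0, 1[. *)
have itvE : (\int[@lebesgue_measure R]_(x in
      [set` Interval (BSide i s) +oo%O] `&` `]0%R, 1%R[) g x =
    \int[@lebesgue_measure R]_(x in `]s, 1%R[) g x)%E.
  have [s_eq0|s_neq0] := eqVneq s 0.
    congr (integral _ _ _); apply/seteqP; split => x /=; rewrite !in_itv/= s_eq0.
      by case.
    by move=> x01; split => //; case: i; rewrite /=; lra.
  have s_gt0 : 0 < s by rewrite lt0r s_neq0.
  transitivity (\int[@lebesgue_measure R]_(x in
      [set` Interval (BSide i s) (BLeft 1%R)]) g x)%E.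
    congr (integral _ _ _); apply/seteqP; split => x /=; rewrite !in_itv/=.
      by case => + /andP[_ ->]; rewrite !andbT.
    by case: i => /=; lra.
  case: i => //; rewrite -integral_itv_obnd_cbnd//.
  exact: measurable_funTS.
rewrite itvE ge0_integralZr//.
- by rewrite integral_onem_powR// -EFinM divfK// lt0r_neq0.
- apply/measurable_EFinP/measurable_funTS.
  apply: (measurableT_comp (measurable_powR (z - 1))).
  exact: measurable_funB.
- by move=> x _; rewrite lee_fin powR_ge0.
- by rewrite lee_fin ltW.
Qed.

(** * Independence and the Markov property *)

Section independence.
Context d (T : measurableType d) (R : realType) (P : probability T R).
Context (I : eqType) (Y : I -> {RV P >-> R}).
Hypothesis indepY : mutually_independent P Y.

Definition cylinder (J : seq I) (B : I -> set R) : set T :=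
  \bigcap_(i in [set` J]) (Y i @^-1` B i).

Lemma measurable_cylinder J B : (forall i, measurable (B i)) ->
  measurable (cylinder J B).
Proof.
move=> mB; apply: fin_bigcap_measurable => [|i _]; first exact: finite_seq.
exact: (measurable_funPTI (Y i) (mB i)).
Qed.

(** Independence is required only on cylinders over the variables indexed by S.
    This form is stable under the operation used along the chain: a variable of S
    is absorbed into X and its index leaves S ([independent_of_pair]). *)
Definition independent_of d' (T' : measurableType d') (S : pred I) (X : T -> T') :=
  forall (A : set T') (J : seq I) (B : I -> set R),
  measurable A -> uniq J -> {subset J <= S} -> (forall i, measurable (B i)) ->
  P (X @^-1` A `&` cylinder J B) = (P (X @^-1` A) * P (cylinder J B))%E.

Lemma independent_of_cst d' (T' : measurableType d') S (x : T') :
  independent_of S (fun=> x).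
Proof.
move=> A J B mA _ _ mB; rewrite preimage_cst; case: ifPn => _.
  by rewrite setTI probability_setT mul1e.
by rewrite set0I measure0 mul0e.
Qed.

Lemma independent_of_comp d1 (T1 : measurableType d1) d2 (T2 : measurableType d2)
    S (X : T -> T1) (f : T1 -> T2) :
  measurable_fun setT f -> independent_of S X -> independent_of S (f \o X).
Proof.
move=> mf iX A J B mA uJ JS mB; rewrite comp_preimage iX//.
by rewrite -[X in measurable X]setTI; exact: mf.
Qed.

Lemma independent_of_sub d' (T' : measurableType d') (S S' : pred I) (X : T -> T') :
  {subset S' <= S} -> independent_of S X -> independent_of S' X.
Proof. by move=> SS iX A J B mA uJ JS mB; rewrite iX// => j /JS/SS. Qed.

Lemma probability_cylinder_cons i J B : i \notin J -> uniq J ->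
  (forall i, measurable (B i)) ->
  P (cylinder (i :: J) B) = (P (Y i @^-1` B i) * P (cylinder J B))%E.
Proof.
move=> iJ uJ mB; rewrite /cylinder !indepY//= ?iJ//.
by rewrite big_cons.
Qed.

Section pair.
Context d' (T' : measurableType d') (S : pred I) (X : {mfun T >-> T'}) (i : I).
Hypotheses (iX : independent_of S X) (iS : i \in S).

Definition pair_with (t : T) : T' * R := (X t, Y i t).

Lemma measurable_pair_with : measurable_fun setT pair_with.
Proof. exact: measurable_fun_pair. Qed.

HB.instance Definition _ := isMeasurableFun.Build _ _ _ _ _ measurable_pair_with.

Lemma pair_with_rect A B : measurable A -> measurable B ->
  P (pair_with @^-1` (A `*` B)) = (P (X @^-1` A) * P (Y i @^-1` B))%E.
Proof.
move=> mA mB; have := iX mA (_ : uniq [:: i]) _ (fun=> mB).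
rewrite probability_cylinder_cons//= => /(_ erefl).
rewrite {2}/cylinder /= .
have -> : [set` [::]] = set0 :> set I by apply/seteqP; split.
rewrite bigcap_set0 probability_setT mule1 => <-; last first.
  by move=> j; rewrite inE => /eqP ->.
congr (P _); apply/seteqP; split => t /=.
  by case=> tA tB; split => // j /=; rewrite inE => /eqP ->.
by case=> tA /(_ i) /=; rewrite inE eqxx => /(_ isT) tB; split.
Qed.

Lemma distribution_pair_with C : measurable C ->
  distribution P pair_with C = (distribution P X \x distribution P (Y i))%E C.
Proof.
move=> mC; apply/esym; apply: product_measure_unique => // A B mA mB.
exact: pair_with_rect.
Qed.

(** For a fixed cylinder both sides are finite measures in C which agree on
    rectangles. *)
Lemma independent_of_pair : independent_of (predD1 S i) pair_with.
Proof.
move=> C J B mC uJ JS mB.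
have mE := measurable_cylinder J mB.
set E := cylinder J B in mE *.
have PE : P E \is a fin_num by exact: fin_num_measure.
have PE0 : 0 <= fine (P E) by exact: fine_ge0.
(* m1 is the law of the pair restricted to the cylinder E, m2 its multiple by P E. *)
pose m1 := measure_function_pushforward__canonical__measure_function_Measure
  (mrestr P mE) measurable_pair_with.
pose m2 := mscale (NngNum PE0) (distribution P pair_with).
suff -> : P (pair_with @^-1` C `&` E) = m2 C.
  by rewrite /m2 /mscale/= muleC fineK.
apply: (@eq_finite_measure_rect _ _ _ _ _ m1 m2) => //.
  rewrite /m1/= /pushforward /mrestr preimage_setT setTI.
  exact: le_lt_trans (probability_le1 _ mE) (ltry _).
move=> A A' mA mA'.
rewrite /m1/= /m2/= /pushforward /mrestr /mscale/= /distribution/= /pushforward.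
rewrite pair_with_rect// fineK// /E.
pose B' j := if j == i then A' else B j.
have iJ : i \notin J.
  by apply/negP => /JS; rewrite !inE eqxx.
have BJ : cylinder J B = cylinder J B'.
  apply/seteqP; split => t H j /= jJ; have := H j jJ;
  by rewrite /B'; case: eqP => // ji; move: iJ; rewrite -ji jJ.
have mB' j : measurable (B' j) by rewrite /B'; case: ifP.
have := iX mA (_ : uniq (i :: J)) _ mB'.
rewrite probability_cylinder_cons//= iJ uJ => /(_ isT).
have Bi : B' i = A' by rewrite /B' eqxx.
rewrite Bi -BJ muleA muleC => <-.
  congr (P _); apply/seteqP; split => t /=.
    case=> -[tA tA'] tE; split => // j /=; rewrite inE => /predU1P[->|jJ].
      by rewrite Bi.
    by move: tE; rewrite BJ => /(_ j jJ).
  case=> tA tE; split; last first.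
    by rewrite BJ => j /= jJ; apply: (tE j); rewrite /= inE jJ orbT.
  split => //; have /= := tE i; rewrite Bi; apply.
  by rewrite inE eqxx.
by move=> j; rewrite inE => /predU1P[->//|/JS /andP[]].
Qed.

(** The joint law of X and Y i is a product, so Tonelli's theorem integrates out
    Y i with X kept fixed. *)
Lemma integrate_out (f : T' * R -> \bar R) :
  measurable_fun setT f -> (forall x, 0 <= f x)%E ->
  (\int[P]_t f (X t, Y i t) =
   \int[P]_t \int[distribution P (Y i)]_y f (X t, y))%E.
Proof.
move=> mf f0.
transitivity (\int[distribution P pair_with]_z f z)%E.
  by rewrite ge0_integral_distribution.
rewrite (eq_measure_integral (distribution P X \x distribution P (Y i))%E).
  rewrite fubini_tonelli1//= ge0_integral_distribution//.
  - exact: measurable_fun_fubini_tonelli_F.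
  - by move=> x; exact: integral_ge0.
by move=> A mA _; exact: distribution_pair_with.
Qed.

End pair.
End independence.

Section chain.
Context (R : realType) (d : measure_display) (T : measurableType d)
  (P : probability T R) (L Rt U : nat -> {RV P >-> R}) (p : R -> R).
Hypothesis mp : measurable_fun setT p.

Definition noise (i : nat + nat + nat) : {RV P >-> R} :=
  match i with
  | inl (inl n) => L n.+1
  | inl (inr n) => Rt n.+1
  | inr n => U n.+1
  end.

(** The family numbers the variables used in the move from X_n to X_(n+1) by n;
    thus X_n involves only the variables of time below n. *)
Definition noise_time (i : nat + nat + nat) : nat :=
  match i with
  | inl (inl n) => n
  | inl (inr n) => n
  | inr n => n
  end.

Hypothesis indep : mutually_independent P (noise_family L Rt U).

Lemma indep_noise : mutually_independent P noise.
Proof.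
have <- // : noise_family L Rt U = (fun i => noise i : T -> R).
by apply/funext => -[[n|n]|n].
Qed.

Definition step (q : R * R * R * R) : R := chain_step p q.1.1.1 q.1.1.2 q.1.2 q.2.

Lemma measurable_step : measurable_fun setT step.
Proof.
have mi : measurable_fun setT
    (fun q : R * R * R * R => (if q.2 < p q.1.1.1 then 1 else 0) : R).
  apply: measurable_fun_ifT => //; apply: measurable_fun_ltr => //.
  apply: (measurableT_comp mp).
  by do 2 apply: measurableT_comp => //.
rewrite /step /chain_step; apply: measurable_funD.
  apply: measurable_funB; first by do 2 apply: measurableT_comp => //.
  apply: measurable_funM => //; apply: measurable_funM.
    by do 2 apply: measurableT_comp => //.
  by do 2 apply: measurableT_comp => //.
apply: measurable_funM; last exact: measurable_funB.
apply: measurable_funM; last exact: measurableT_comp.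
by apply: measurable_funB => //; do 2 apply: measurableT_comp => //.
Qed.

(** The Markov operator of the chain, read off its first move. *)
Definition transition (f : R -> \bar R) (x : R) : \bar R :=
  (\int[P]_t f (chain_step p x (L 1 t) (Rt 1 t) (U 1 t)))%E.

Lemma measurable_chain x0 n : measurable_fun setT (chain p L Rt U x0 n).
Proof.
elim: n => [|n IHn]; first exact: measurable_cst.
rewrite [X in measurable_fun _ X](_ : _ = fun t =>
  step (chain p L Rt U x0 n t, L n.+1 t, Rt n.+1 t, U n.+1 t))//.
apply: (measurableT_comp measurable_step).
by do 3 (apply: measurable_fun_pair => //).
Qed.

HB.instance Definition _ x0 n :=
  isMeasurableFun.Build _ _ _ _ _ (measurable_chain x0 n).

Hypotheses
  (idL : forall n A, measurable A -> distribution P (L n.+1) A = distribution P (L 1) A)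
  (idR : forall n A, measurable A -> distribution P (Rt n.+1) A = distribution P (Rt 1) A)
  (idU : forall n A, measurable A -> distribution P (U n.+1) A = distribution P (U 1) A).

Let later n : pred (nat + nat + nat) := [pred i | n <= noise_time i]%N.

Let noise_integral (f : R -> \bar R) (x : R) : \bar R :=
  (\int[distribution P (L 1)]_l \int[distribution P (Rt 1)]_r
    \int[distribution P (U 1)]_u f (step (x, l, r, u)))%E.

(** [integrate_out] is applied to U, then to Rt, then to L; the resulting integral over
    the noise does not depend on n because the laws do not. *)
Let integral_step n (X : {mfun T >-> R}) (f : R -> \bar R) :
  independent_of noise (later n) X ->
  measurable_fun setT f -> (forall x, 0 <= f x)%E ->
  (\int[P]_t f (step (X t, L n.+1 t, Rt n.+1 t, U n.+1 t)) =
   \int[P]_t noise_integral f (X t))%E.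
Proof.
move=> iX mf f0.
pose X1 := pair_with noise X (inl (inl n)).
pose X2 := pair_with noise X1 (inl (inr n)).
have iX1 := independent_of_pair indep_noise iX (leqnn n : inl (inl n) \in later n).
have iR : inl (inr n) \in predD1 (later n) (inl (inl n)) by rewrite /later !inE /= leqnn.
have iX2 := independent_of_pair indep_noise iX1 iR.
have iU : inr n \in predD1 (predD1 (later n) (inl (inl n))) (inl (inr n)).
  by rewrite /later !inE /= leqnn.
pose f3 (q : R * R * R * R) := f (step q).
have mf3 : measurable_fun setT f3 by exact: measurableT_comp measurable_step.
have f30 q : (0 <= f3 q)%E by exact: f0.
pose f2 (q : R * R * R) := (\int[distribution P (U 1)]_u f3 (q, u))%E.
have mf2 : measurable_fun setT f2 by exact: measurable_fun_fubini_tonelli_F.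
have f20 q : (0 <= f2 q)%E by exact: integral_ge0.
pose f1 (q : R * R) := (\int[distribution P (Rt 1)]_r f2 (q, r))%E.
have mf1 : measurable_fun setT f1 by exact: measurable_fun_fubini_tonelli_F.
have f10 q : (0 <= f1 q)%E by exact: integral_ge0.
transitivity (\int[P]_t f2 (X2 t))%E.
  rewrite (integrate_out indep_noise iX2 iU mf3 f30); apply: eq_integral => t _.
  by apply: eq_measure_integral => A mA _; exact: idU.
transitivity (\int[P]_t f1 (X1 t))%E.
  rewrite (integrate_out indep_noise iX1 iR mf2 f20); apply: eq_integral => t _.
  by apply: eq_measure_integral => A mA _; exact: idR.
rewrite (integrate_out indep_noise iX (leqnn n : inl (inl n) \in later n) mf1 f10).
apply: eq_integral => t _.
by apply: eq_measure_integral => A mA _; exact: idL.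
Qed.

Lemma independent_of_chain x0 n :
  independent_of noise (later n) (chain p L Rt U x0 n).
Proof.
elim: n => [|n iX]; first exact: independent_of_cst.
pose X1 := pair_with noise (chain p L Rt U x0 n) (inl (inl n)).
pose X2 := pair_with noise X1 (inl (inr n)).
have iX1 := independent_of_pair indep_noise iX (leqnn n : inl (inl n) \in later n).
have iR : inl (inr n) \in predD1 (later n) (inl (inl n)) by rewrite /later !inE /= leqnn.
have iX2 := independent_of_pair indep_noise iX1 iR.
have iU : inr n \in predD1 (predD1 (later n) (inl (inl n))) (inl (inr n)).
  by rewrite /later !inE /= leqnn.
have iX3 := independent_of_pair indep_noise iX2 iU.
apply: (independent_of_sub _ (independent_of_comp measurable_step iX3)).
move=> i; rewrite /later !inE => ni; rewrite (ltnW ni) !andbT.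
by move: ni; case: i => [[m|m]|m] /=; rewrite ?andbT //;
  case: eqP => // -[->]; rewrite ltnn.
Qed.

Lemma transitionE (f : R -> \bar R) x :
  measurable_fun setT f -> (forall x, 0 <= f x)%E ->
  transition f x = noise_integral f x.
Proof.
move=> mf f0.
rewrite [LHS](@integral_step 0 (cst x))//; last exact: independent_of_cst.
rewrite (_ : (fun t => _) = cst (noise_integral f x))//.
by rewrite integral_cst//= probability_setT mule1.
Qed.

Lemma transition_ge0 f x : (forall x, 0 <= f x)%E -> (0 <= transition f x)%E.
Proof. by move=> f0; exact: integral_ge0. Qed.

Lemma measurable_transition (f : R -> \bar R) :
  measurable_fun setT f -> (forall x, 0 <= f x)%E ->
  measurable_fun setT (transition f).
Proof.
move=> mf f0.
pose g (q : R * T) := f (step (q.1, L 1 q.2, Rt 1 q.2, U 1 q.2)).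
have mg : measurable_fun setT g.
  apply: (measurableT_comp mf); apply: (measurableT_comp measurable_step).
  by do 3 (apply: measurable_fun_pair => //; last exact: measurableT_comp).
have g0 q : (0 <= g q)%E by exact: f0.
exact: (@measurable_fun_fubini_tonelli_F _ _ _ _ _ P g mg g0).
Qed.

Lemma markov_property (f : R -> \bar R) x0 n :
  measurable_fun setT f -> (forall x, 0 <= f x)%E ->
  (\int[P]_t f (chain p L Rt U x0 n t) = iter n transition f x0)%E.
Proof.
elim: n f => [f mf f0|n IHn f mf f0].
  rewrite (_ : (fun t => _) = cst (f x0))//.
  by rewrite integral_cst//= probability_setT mule1.
rewrite iterSr -IHn; last 2 first.
- exact: measurable_transition.
- by move=> x; exact: transition_ge0.
rewrite [LHS](integral_step (@independent_of_chain x0 n))//.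
by apply: eq_integral => t _; rewrite transitionE.
Qed.

End chain.

(** * Ergodicity from a two-step minorization *)

Lemma integral_carrier d (T : measurableType d) (R : realType)
    (mu : probability T R) (D : set T) (f : T -> \bar R) :
  measurable D -> mu D = 1%E -> measurable_fun setT f -> (forall x, 0 <= f x)%E ->
  (\int[mu]_x f x = \int[mu]_(x in D) f x)%E.
Proof.
move=> mD muD mf f0.
have muDC : mu (~` D) = 0%E by rewrite probability_setC// muD subee.
rewrite (ge0_negligible_integral (measurableC mD) measurableT mf _ muDC)//.
by rewrite setTD setCK.
Qed.

Section doeblin.
Context (R : realType) (d : measure_display) (T : measurableType d)
  (P : probability T R) (L Rt U : nat -> {RV P >-> R}) (p : R -> R).
Hypothesis mp : measurable_fun setT p.
Hypothesis indep : mutually_independent P (noise_family L Rt U).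
Hypotheses
  (idL : forall n A, measurable A -> distribution P (L n.+1) A = distribution P (L 1) A)
  (idR : forall n A, measurable A -> distribution P (Rt n.+1) A = distribution P (Rt 1) A)
  (idU : forall n A, measurable A -> distribution P (U n.+1) A = distribution P (U 1) A).

Let X := chain p L Rt U.
Let K : (R -> \bar R) -> R -> \bar R := transition L Rt U p.
Let Xrv x n : {RV P >-> R} :=
  HB.pack (X x n) (isMeasurableFun.Build _ _ _ _ _ (measurable_chain L Rt U mp x n)).

Hypothesis law01 : forall x : R, 0 <= x <= 1 -> P (X x 1 @^-1` `[0, 1]%classic) = 1%E.

Variables (eps : R) (nu : probability R R).
Hypotheses (eps01 : 0 < eps <= 1) (nu01 : nu `[0, 1]%classic = 1%E).
Hypothesis minorization : forall (f : R -> \bar R) (x : R),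
  measurable_fun setT f -> (forall y, 0 <= f y)%E -> 0 <= x <= 1 ->
  (eps%:E * \int[nu]_y f y <= K (K f) x)%E.

Let mK (f : R -> \bar R) : measurable_fun setT f -> (forall x, 0 <= f x)%E ->
  measurable_fun setT (K f).
Proof. exact: measurable_transition. Qed.

Let K0 (f : R -> \bar R) : (forall x, 0 <= f x)%E -> forall x, (0 <= K f x)%E.
Proof. by move=> f0 x; exact: transition_ge0. Qed.

Let KE (f : R -> \bar R) x : measurable_fun setT f -> (forall x, 0 <= f x)%E ->
  K f x = (\int[distribution P (Xrv x 1)]_y f y)%E.
Proof. by move=> mf f0; rewrite ge0_integral_distribution. Qed.

Let I01 : set R := `[0, 1]%classic.
Let mI01 : measurable I01. Proof. exact: measurable_itv. Qed.

(** Truncating the differences at 0 keeps every integral in the nonnegative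
    extended reals.  It changes nothing on [0, 1], which carries mu. *)
Lemma integral_bracket (mu : probability R R) (f : R -> \bar R) (m M : R) :
  mu I01 = 1%E -> 0 <= m -> m <= M -> measurable_fun setT f -> (forall x, 0 <= f x)%E ->
  (forall x, I01 x -> (m%:E <= f x <= M%:E)%E) ->
  (\int[mu]_x f x = \int[mu]_x maxe (f x - m%:E) 0 + m%:E /\
   \int[mu]_x f x + \int[mu]_x maxe (M%:E - f x) 0 = M%:E)%E.
Proof.
move=> muI m0 mM mf f0 fmM.
have mlow : measurable_fun setT (fun x => maxe (f x - m%:E) 0)%E.
  by apply: measurable_maxe => //; exact: emeasurable_funB.
have mupp : measurable_fun setT (fun x => maxe (M%:E - f x) 0)%E.
  by apply: measurable_maxe => //; exact: emeasurable_funB.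
have low0 x : (0 <= maxe (f x - m%:E) 0)%E by rewrite le_max lexx orbT.
have upp0 x : (0 <= maxe (M%:E - f x) 0)%E by rewrite le_max lexx orbT.
have cstI r : (\int[mu]_(x in I01) r%:E = r%:E)%E.
  by rewrite integral_cst// -[RHS]mule1; congr (_ * _)%E; exact: muI.
rewrite !(integral_carrier mI01 muI)//; split.
  rewrite -{2}(cstI m) -ge0_integralD//; last exact: measurable_funTS.
  apply: eq_integral => x; rewrite inE => /fmM /andP[mfx fxM].
  by rewrite max_l ?sube_ge0// subeK.
rewrite -[RHS](cstI M) -ge0_integralD//; try exact: measurable_funTS.
apply: eq_integral => x; rewrite inE => /fmM /andP[mfx fxM].
have fx : f x \is a fin_num.
  by rewrite fin_real// (lt_le_trans _ mfx) ?ltNyr// (le_lt_trans fxM) ?ltry.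
by rewrite max_l ?sube_ge0 ?fx// addeC subeK.
Qed.

Let bracketed (f : R -> \bar R) (m M : R) :=
  forall x, I01 x -> (m%:E <= f x <= M%:E)%E.

Lemma integral_bracketed (mu : probability R R) (f : R -> \bar R) (m M : R) :
  mu I01 = 1%E -> 0 <= m -> m <= M -> measurable_fun setT f -> (forall x, 0 <= f x)%E ->
  bracketed f m M -> (m%:E <= \int[mu]_x f x <= M%:E)%E.
Proof.
move=> muI m0 mM mf f0 fmM.
have [E1 E2] := integral_bracket muI m0 mM mf f0 fmM.
have max0 (g : R -> \bar R) : (0 <= \int[mu]_x maxe (g x) 0)%E.
  by apply: integral_ge0 => x _; rewrite le_max lexx orbT.
apply/andP; split; first by rewrite E1 leeDr.
by rewrite -[leRHS]E2 leeDl.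
Qed.

Lemma transition_bracketed (f : R -> \bar R) (m M : R) :
  0 <= m -> m <= M -> measurable_fun setT f -> (forall x, 0 <= f x)%E ->
  bracketed f m M -> bracketed (K f) m M.
Proof.
move=> m0 mM mf f0 fmM x x01; rewrite KE//.
by apply: integral_bracketed => //; apply: law01; rewrite /I01/= in_itv in x01.
Qed.

(** The minorization applied to f - m raises the lower bound m by eps times the
    integral of f - m against nu; applied to M - f it lowers M by eps times the
    integral of M - f.  The two gains add up to eps (M - m). *)
Lemma transition2_contracts (f : R -> \bar R) (m M : R) :
  0 <= m -> m <= M -> measurable_fun setT f -> (forall x, 0 <= f x)%E ->
  bracketed f m M ->
  exists m' M', [/\ 0 <= m', m' <= M', M' - m' = (1 - eps) * (M - m) &
    bracketed (K (K f)) m' M'].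
Proof.
move=> m0 mM mf f0 fmM; have /andP[eps0 eps1] := eps01.
pose g (x : R) : \bar R := maxe (f x - m%:E)%E 0%E.
pose h (x : R) : \bar R := maxe (M%:E - f x)%E 0%E.
have mg : measurable_fun setT g.
  by apply: measurable_maxe => //; exact: emeasurable_funB.
have mh : measurable_fun setT h.
  by apply: measurable_maxe => //; exact: emeasurable_funB.
have g0 x : (0 <= g x)%E by rewrite le_max lexx orbT.
have h0 x : (0 <= h x)%E by rewrite le_max lexx orbT.
have K1 x : I01 x -> K f x = (K g x + m%:E)%E /\ (K f x + K h x = M%:E)%E.
  move=> x01; rewrite !KE//; apply: integral_bracket => //.
  by apply: law01; rewrite /I01/= in_itv in x01.
have K2 x : I01 x -> K (K f) x = (K (K g) x + m%:E)%E /\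
    (K (K f) x + K (K h) x = M%:E)%E.
  move=> x01; rewrite !(KE x (mK _ _) (K0 _))//.
  have muI : distribution P (Xrv x 1) I01 = 1%E.
    by apply: law01; rewrite /I01/= in_itv in x01.
  have cstI r : (\int[distribution P (Xrv x 1)]_(x in I01) r%:E = r%:E)%E.
    by rewrite integral_cst// -[RHS]mule1; congr (_ * _)%E; exact: muI.
  rewrite !(integral_carrier mI01 muI)//; try exact: K0; try exact: mK.
  split.
    rewrite -(cstI m) -ge0_integralD//; try by move=> *; exact: K0.
    + by apply: eq_integral => y; rewrite inE => /K1[].
    + by apply: measurable_funTS; exact: mK.
  rewrite -[RHS](cstI M) -ge0_integralD//; try by move=> *; exact: K0.
  - by apply: eq_integral => y; rewrite inE => /K1[].
  - by apply: measurable_funTS; exact: mK.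
  - by apply: measurable_funTS; exact: mK.
have [N1 N2] := integral_bracket nu01 m0 mM mf f0 fmM.
have ig0 : (0 <= \int[nu]_x g x)%E by exact: integral_ge0.
have ih0 : (0 <= \int[nu]_x h x)%E by exact: integral_ge0.
have if0 : (0 <= \int[nu]_x f x)%E by exact: integral_ge0.
move: N1 N2; rewrite -/g -/h => N1 N2.
have ming x : I01 x -> (eps%:E * \int[nu]_y g y <= K (K g) x)%E.
  by move=> x01; apply: minorization => //; rewrite /I01/= in_itv in x01.
have minh x : I01 x -> (eps%:E * \int[nu]_y h y <= K (K h) x)%E.
  by move=> x01; apply: minorization => //; rewrite /I01/= in_itv in x01.
move: N1 N2 ming minh if0 ig0 ih0.
case: (\int[nu]_x f x)%E => [r| |] //; case: (\int[nu]_x g x)%E => [rg| |] //;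
  case: (\int[nu]_x h x)%E => [rh| |] //.
rewrite -!EFinD => -[rE] [ME] ming minh; rewrite !lee_fin => r0 rg0 rh0.
(* rg and rh are the integrals of f - m and M - f against nu. *)
exists (m + eps * rg), (M - eps * rh); split.
- by rewrite addr_ge0// mulr_ge0// ltW.
- have : 0 <= (1 - eps) * (M - m) by rewrite mulr_ge0; lra.
  have : (1 - eps) * (M - m) = M - m - eps * rg - eps * rh by rewrite -ME rE; ring.
  lra.
- by rewrite -ME rE; ring.
- move=> x x01; have [E1 E2] := K2 x x01; apply/andP; split.
    by rewrite E1 EFinD addeC leeD2r// EFinM ming.
  rewrite EFinB -E2 leeBrDr//.
  by rewrite leeD2l// EFinM minh.
Qed.

Let KA (A : set R) n : R -> \bar R := iter n K (fun x => (\1_A x)%:E).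

Let KA_ge0 A n x : (0 <= KA A n x)%E.
Proof. by elim: n x => [|n IHn] x; [rewrite lee_fin|exact: K0]. Qed.

Let measurable_KA A n : measurable A -> measurable_fun setT (KA A n).
Proof.
move=> mA; elim: n => [|n IHn]; first by apply/measurable_EFinP; exact: measurable_indic.
by apply: mK => //; exact: KA_ge0.
Qed.

(** The bracket shrinks once every two steps, whence the exponent n./2. *)
Let KA_bracketed A n : measurable A -> exists m M, [/\ 0 <= m, m <= M,
  M - m = (1 - eps) ^+ n./2 & bracketed (KA A n) m M].
Proof.
move=> mA; have base : bracketed (KA A 0) 0 1.
  by move=> x _; rewrite !lee_fin indicE; case: (x \in A); rewrite lexx ler01.
elim/ltn_ind: n => -[_|[_|n IHn]].
- by exists 0, 1; split; rewrite ?ler01 ?subr0 ?expr0.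
- exists 0, 1; split; rewrite ?ler01 ?subr0 ?expr0//.
  by apply: transition_bracketed => //; exact: (measurable_KA 0).
- have [m [M [m0 mM MmE br]]] := IHn n (leqnSn _).
  have [||m' [M' [m'0 m'M' E br']]] := transition2_contracts m0 mM _ _ br.
  + exact: measurable_KA.
  + exact: KA_ge0.
  exists m', M'; split => //.
  by rewrite E MmE -exprS.
Qed.

Lemma law_iter (A : set R) x n : measurable A ->
  law_at P X x n A = iter n K (fun x => (\1_A x)%:E) x.
Proof.
move=> mA.
have m1 : measurable_fun setT (fun x : R => (\1_A x)%:E : \bar R).
  by apply/measurable_EFinP; exact: measurable_indic.
have ge0 y : (0 <= (\1_A y)%:E :> \bar R)%E by rewrite lee_fin.
rewrite /K -(markov_property mp indep idL idR idU x n m1 ge0).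
have mXA := measurable_funPTI (Xrv x n) mA.
transitivity (\int[P]_t (\1_(X x n @^-1` A) t)%:E)%E; last by [].
by rewrite integral_indic// setIT.
Qed.

Lemma measurable_law (A : set R) : measurable A ->
  measurable_fun setT (fun x => law_at P X x 1 A).
Proof.
move=> mA; pose f (x : R) : \bar R := (\1_A x)%:E.
have mf : measurable_fun setT f by apply/measurable_EFinP; exact: measurable_indic.
have f0 x : (0 <= f x)%E by rewrite lee_fin.
have := measurable_transition L Rt U mp mf f0.
congr (measurable_fun _ _); apply/funext => x; rewrite /law_at.
have mXA := measurable_funPTI (Xrv x 1) mA.
transitivity (\int[P]_t (\1_(X x 1 @^-1` A) t)%:E)%E; first by [].
by rewrite integral_indic// setIT.
Qed.

Section moved_law.
Variable mu : probability R R.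

Let first_move (q : R * T) : R := X q.1 1 q.2.

Let measurable_first_move : measurable_fun setT first_move.
Proof.
apply: (measurableT_comp (measurable_step mp)
  (g := fun q : R * T => (q.1, L 1 q.2, Rt 1 q.2, U 1 q.2))).
by do 3 (apply: measurable_fun_pair => //; last exact: measurableT_comp).
Qed.

(** The law after one move of the chain whose initial law is mu. *)
Definition moved_law : {measure set R -> \bar R} :=
  measure_function_pushforward__canonical__measure_function_Measure
    (mu \x P)%E measurable_first_move.

Lemma moved_lawE (A : set R) :
  measurable A -> moved_law A = (\int[mu]_x law_at P X x 1 A)%E.
Proof.
move=> mA; apply: eq_integral => x _; rewrite /law_at /xsection /=.
by congr (P _); apply/seteqP; split => t /=; rewrite inE.
Qed.

Lemma integral_moved_law (f : R -> \bar R) :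
  measurable_fun setT f -> (forall x, 0 <= f x)%E ->
  (\int[moved_law]_x f x = \int[mu]_x K f x)%E.
Proof.
move=> mf f0; rewrite ge0_integral_pushforward//= fubini_tonelli1//.
exact: (measurableT_comp mf measurable_first_move).
Qed.

End moved_law.

Section stationary.
Variable mu : probability R R.
Hypotheses (mu01 : mu I01 = 1%E)
  (mu_stat : forall A : set R, measurable A -> (\int[mu]_x law_at P X x 1 A = mu A)%E).

Lemma integral_stationary (f : R -> \bar R) :
  measurable_fun setT f -> (forall x, 0 <= f x)%E ->
  (\int[mu]_x K f x = \int[mu]_x f x)%E.
Proof.
move=> mf f0; rewrite -integral_moved_law//; apply: eq_measure_integral => A mA _.
by rewrite moved_lawE// mu_stat.
Qed.

Lemma stationary_iter (A : set R) n : measurable A -> (\int[mu]_x KA A n x = mu A)%E.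
Proof.
move=> mA; elim: n => [|n IHn]; first by rewrite integral_indic// setIT.
by rewrite -IHn -(integral_stationary (measurable_KA n mA) (KA_ge0 A n)).
Qed.

(** The mass mu A is the integral of [KA A n] against mu, hence lies in the same
    bracket as the values of [KA A n] on [0, 1]. *)
Lemma law_close_stationary (A : set R) x n : measurable A -> 0 <= x <= 1 ->
  (`|law_at P X x n A - mu A| <= ((1 - eps) ^+ n./2)%:E)%E.
Proof.
move=> mA x01; have [m [M [m0 mM <- br]]] := KA_bracketed n mA.
have x01' : I01 x by rewrite /I01/= in_itv.
have := integral_bracketed mu01 m0 mM (measurable_KA n mA) (KA_ge0 A n) br.
rewrite stationary_iter// law_iter//; have := br _ x01'; rewrite -/(KA A n).
have fin (v : \bar R) : (m%:E <= v <= M%:E)%E -> exists r, v = r%:E.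
  by case: v => [r _|/andP[_]|/andP[]]; [exists r|rewrite leye_eq|rewrite leeNy_eq].
move=> /[dup]/fin[r ->] rmM /[dup]/fin[s ->] smM; move: rmM smM.
rewrite -EFinB abse_EFin !lee_fin ler_norml => rmM smM.
by apply/andP; split; lra.
Qed.

End stationary.

Let measurable_id_rv : measurable_fun setT (fun x : measurableTypeR R => x : R).
Proof. by move=> _ A mA; rewrite setTI. Qed.

Let id_rv : {mfun measurableTypeR R >-> R} :=
  HB.pack (fun x : measurableTypeR R => x : R)
    (isMeasurableFun.Build _ _ _ _ _ measurable_id_rv).

(** The Borel structures of R and of [measurableTypeR R] have the same measurable
    sets but are distinct structures; this transports a probability from the
    second to the first. *)
Let as_real (Pi : probability (measurableTypeR R) R) : probability R R :=
  distribution Pi id_rv.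

Let integral_as_real Pi D f : measurable D -> measurable_fun setT f ->
  (forall y, 0 <= f y)%E ->
  (\int[as_real Pi]_(y in D) f y = \int[Pi]_(y in D) f y)%E.
Proof.
by move=> mD mf f0; rewrite ge0_integral_pushforward//; exact: measurable_funTS.
Qed.

Let integral_law (Pi : probability (measurableTypeR R) R) (A : set R) :
  Pi I01 = 1%E -> measurable A ->
  (\int[as_real Pi]_x law_at P X x 1 A = \int[Pi]_(x in I01) law_at P X x 1 A)%E.
Proof.
move=> Pi01 mA; have mlaw := measurable_law mA.
have law0 y : (0 <= law_at P X y 1 A)%E by [].
by rewrite (integral_carrier mI01 (mu := as_real Pi))// integral_as_real.
Qed.

Lemma stationary01_rays (Pi : probability (measurableTypeR R) R) :
  Pi I01 = 1%E ->
  (forall y : R, \int[Pi]_(x in I01) law_at P X x 1 `]-oo, y[%classic =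
    Pi `]-oo, y[%classic)%E ->
  stationary01 P X Pi.
Proof.
move=> Pi01 rays; split => // A mA.
rewrite -integral_law// -moved_lawE//.
apply: (@eq_measure_rays R (moved_law (as_real Pi)) (as_real Pi)) => // [|y].
  rewrite moved_lawE// /law_at; under eq_integral do rewrite preimage_setT.
  by rewrite probability_setT integral_cst//= probability_setT mule1 ltry.
by rewrite moved_lawE ?integral_law ?rays//; exact: measurable_itv.
Qed.

(** The rate of [law_close_stationary] depends neither on the set, nor on the
    starting point, nor on the stationary law.  This gives convergence in total
    variation, and uniqueness because the law at time n is close to every
    stationary law. *)
Theorem doeblin_ergodic (Pi : probability (measurableTypeR R) R) :
  stationary01 P X Pi -> ergodic01_with P X Pi.
Proof.
move=> PiS; have /andP[eps0 eps1] := eps01.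
have close (Pi' : probability (measurableTypeR R) R) : stationary01 P X Pi' ->
    forall (A : set R) x n, measurable A -> 0 <= x <= 1 ->
    (`|law_at P X x n A - Pi' A| <= ((1 - eps) ^+ n./2)%:E)%E.
  move=> [Pi01 PiE] A x n mA x01.
  apply: (law_close_stationary (mu := as_real Pi')) => // B mB.
  by rewrite integral_law//; exact: PiE.
have rate0 : (1 - eps) ^+ n./2 @[n --> \oo] --> (0 : R).
  apply: (@cvg_comp _ _ _ (fun n => n./2) (fun k => (1 - eps) ^+ k) _ \oo).
    apply/cvgnyPge => N; near=> n.
    rewrite -(doubleK N) half_leq//.
    by near: n; exact: nbhs_infty_ge.
  by apply: cvg_expr; rewrite ger0_norm; lra.
split => //.
- move=> Pi' Pi'S A mA.
  have z01 : 0 <= (0 : R) <= 1 by rewrite lexx ler01.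
  have PA : Pi A \is a fin_num by exact: fin_num_measure.
  have PA' : Pi' A \is a fin_num by exact: fin_num_measure.
  have Pn n : law_at P X 0 n A \is a fin_num.
    by apply: fin_num_measure; exact: (measurable_funPTI (Xrv 0 n) mA).
  rewrite -(fineK PA) -(fineK PA'); congr EFin; apply/eqP.
  rewrite -subr_eq0 -normr_le0; apply/ler_addgt0Pl => e e0; rewrite addr0.
  have e20 : 0 < e / 2 by rewrite divr_gt0.
  move/cvgrPdist_lt : rate0 => /(_ _ e20)[n _ /(_ n (leqnn n))].
  rewrite /= sub0r normrN ger0_norm; last by rewrite exprn_ge0// subr_ge0.
  move: (close _ PiS A 0 n mA z01) (close _ Pi'S A 0 n mA z01).
  rewrite -(fineK (Pn n)) -(fineK PA) -(fineK PA') -!EFinB !abse_EFin !lee_fin.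
  rewrite !ler_norml => ? ? ?; apply/andP; split; lra.
- move=> x0 x01.
  apply: (@squeeze_cvge _ _ _ _ (cst 0%E) _ (fun n => ((1 - eps) ^+ n./2)%:E)).
  + near=> n; apply/andP; split.
      apply: (@le_trans _ _ `|law_at P X x0 n set0 - Pi set0|%E); first exact: abse_ge0.
      apply: ereal_sup_ubound; exists (set0 : set (measurableTypeR R)) => //.
      exact: measurable0.
    by apply: ge_ereal_sup => _ [A mA <-]; exact: close.
  + exact: cvg_cst.
  + by apply: cvg_EFin; [exact: nearW|exact: rate0].
Unshelve. all: by end_near. Qed.

End doeblin.

(** * The transition law of the chain *)

Section kernel.
Context (R : realType) (z b c : R).
Hypotheses (hz : 0 < z) (hb : 0 < b <= 1) (hc : 0 < c <= 1).
Context (d : measure_display) (T : measurableType d) (P : probability T R)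
  (L Rt U : nat -> {RV P >-> R}).
Hypotheses (hL : forall n : nat, has_beta_law 1 z (distribution P (L n.+1)))
  (hR : forall n : nat, has_beta_law 1 z (distribution P (Rt n.+1)))
  (hU : forall n : nat, has_uniform01_law (distribution P (U n.+1)))
  (hind : mutually_independent P (noise_family L Rt U)).

Let p (x : R) : R := c * x + (1 - b) * (1 - x).

Let mp : measurable_fun setT p.
Proof. by apply: measurable_funD; apply: measurable_funM => //; exact: measurable_funB. Qed.

Let p01 x : 0 <= x <= 1 -> 0 <= p x <= 1.
Proof.
move=> /andP[x0 x1]; rewrite /p.
move: (hb) (hc) => /andP[b_gt0 b_le1] /andP[c_gt0 c_le1].
have c0 : 0 <= c * x by rewrite mulr_ge0; lra.
have b0 : 0 <= (1 - b) * (1 - x) by rewrite mulr_ge0; lra.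
have c1 : 0 <= (1 - c) * x by rewrite mulr_ge0; lra.
have b1 : 0 <= b * (1 - x) by rewrite mulr_ge0; lra.
by apply/andP; split; lra.
Qed.

Lemma beta1_itvcc (Y : {RV P >-> R}) (s t : R) :
  has_beta_law 1 z (distribution P Y) -> 0 <= s -> s <= t -> t <= 1 ->
  P (Y @^-1` `[s, t]%classic) = ((1 - s) `^ z - (1 - t) `^ z)%:E.
Proof.
move=> hY s0 st t1.
have E1 := @beta1_tail R z s true _ hY hz (_ : 0 <= s <= 1).
have E2 := @beta1_tail R z t false _ hY hz (_ : 0 <= t <= 1).
have -> : Y @^-1` `[s, t]%classic = Y @^-1` `[s, +oo[%classic `\` Y @^-1` `]t, +oo[%classic.
  apply/seteqP; split => w /=; rewrite !in_itv/= !andbT.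
    by case/andP => -> ?; split=> //; apply/negP; rewrite -leNgt.
  by case=> -> /negP; rewrite -leNgt.
rewrite measureD//; last 3 first.
- by apply: (measurable_funPTI Y); exact: measurable_itv.
- by apply: (measurable_funPTI Y); exact: measurable_itv.
- rewrite (le_lt_trans (probability_le1 _ _)) ?ltry//.
  by apply: (measurable_funPTI Y); exact: measurable_itv.
rewrite setIidr; last first.
  by move=> w /=; rewrite !in_itv/= !andbT => /ltW; exact: le_trans.
by rewrite EFinB -E1 ?s0 ?(le_trans st)// -E2 // t1 (le_trans s0).
Qed.

Let clip (x : R) := Num.min (Num.max x 0) 1.

(** x - x Y = x (1 - Y), and 1 - Y has distribution function s^z on [0, 1].
    Clipping makes the formula valid for every y, as 0^z = 0. *)
Lemma beta1_cdf (Y : {RV P >-> R}) (x y : R) (i : bool) :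
  has_beta_law 1 z (distribution P Y) -> 0 < x ->
  P ([set t | x - x * Y t < y ?<= if i]) = (clip (y / x) `^ z)%:E.
Proof.
move=> hY x0.
have -> : [set t | x - x * Y t < y ?<= if i] =
    Y @^-1` [set` Interval (BSide i (1 - y / x)) +oo%O].
  apply/seteqP; split => t /=; rewrite in_itv/= andbT.
    case: i => /=.
      by move=> H; rewrite -(ler_pM2l x0) mulrBr mulr1 mulrCA divff ?mulr1 ?lt0r_neq0//; lra.
    by move=> H; rewrite -(ltr_pM2l x0) mulrBr mulr1 mulrCA divff ?mulr1 ?lt0r_neq0//; lra.
  case: i => /=.
    by rewrite -(ler_pM2l x0) mulrBr mulr1 mulrCA divff ?mulr1 ?lt0r_neq0//; lra.
  by rewrite -(ltr_pM2l x0) mulrBr mulr1 mulrCA divff ?mulr1 ?lt0r_neq0//; lra.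
set w := y / x; rewrite /clip.
have tail s := @beta1_tail R z s i _ hY hz.
have mI s : measurable ([set` Interval (BSide i s) +oo%O] : set R).
  exact: measurable_itv.
have le_itv (s s' : R) : s' <= s ->
    [set` Interval (BSide i s) +oo%O] `<=` [set` Interval (BSide i s') +oo%O].
  by move=> ss t /=; rewrite !in_itv/= !andbT; case: (i) => /=; lra.
have [w0|w0] := leP w 0.
  rewrite (_ : Num.min 0 1 = 0); last by apply/min_idPl.
  rewrite powR0 ?lt0r_neq0//; apply/eqP; rewrite eq_le measure_ge0 andbT.
  have := tail 1; rewrite ler01 lexx subrr powR0 ?lt0r_neq0// => <- //.
  apply: (@le_measure _ _ _ (distribution P Y)); rewrite ?inE; [exact: mI|exact: mI|].
  by move=> t; apply: le_itv; lra.
have [w1|w1] := leP w 1.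
  rewrite -[w in RHS](subKr 1).
  by rewrite -tail//; lra.
rewrite powR1; apply/eqP; rewrite eq_le probability_le1/=; last first.
  exact: (measurable_funPTI Y (mI _)).
have := tail 0; rewrite ler01 lexx subr0 powR1 => <- //.
apply: (@le_measure _ _ _ (distribution P Y)); rewrite ?inE; [exact: mI|exact: mI|].
by apply: le_itv; lra.
Qed.

Lemma uniform01_lt (Y : {RV P >-> R}) (q : R) : has_uniform01_law (distribution P Y) ->
  0 <= q <= 1 -> P (Y @^-1` `]-oo, q[%classic) = q%:E.
Proof.
move=> hY q01; have := hY `]-oo, q[%classic (measurable_itv _).
rewrite /distribution/= /pushforward => ->.
rewrite /uniform_prob integral_uniform_pdf.
have -> : (`]-oo, q[ `&` `[0, 1] = `[0, q[ :> set R)%classic.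
  by apply/seteqP; split => x /=; rewrite !in_itv/=; lra.
rewrite (eq_integral (fun=> 1%:E)); last first.
  move=> x; rewrite inE/= in_itv/= => xq; rewrite /uniform_pdf.
  by rewrite ifT ?subr0 ?invr1//; lra.
rewrite integral_cst//= mul1e lebesgue_measure_itv/= lte_fin.
case: ltP => q0; first by rewrite -EFinB subr0.
by congr EFin; lra.
Qed.

Lemma indep_pair (i j : nat + nat + nat) (A B : set R) : i != j ->
  measurable A -> measurable B ->
  P ((noise L Rt U i @^-1` A) `&` (noise L Rt U j @^-1` B)) =
  (P (noise L Rt U i @^-1` A) * P (noise L Rt U j @^-1` B))%E.
Proof.
move=> ij mA mB.
have mC k : measurable (if k == i then A else B) by case: ifP.
have := indep_noise hind (J := [:: i; j]) (B := fun k => if k == i then A else B).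
rewrite /= inE ij => /(_ isT mC).
rewrite !big_cons big_nil mule1 eqxx eq_sym (negbTE ij) => <-.
congr (P _); apply/seteqP; split => t /=.
  case=> tA tB k /=; rewrite !inE => /orP[|] /eqP ->; rewrite ?eqxx//.
  by rewrite eq_sym (negbTE ij).
move=> H; split.
  by have /= := H i; rewrite !inE eqxx; apply.
have /= := H j; rewrite !inE eqxx orbT; rewrite eq_sym (negbTE ij); exact.
Qed.

Let X := chain p L Rt U.

Let moved_left (x : R) (A : set R) : set T := [set t | A (x - x * L 1 t)].
Let moved_right (x : R) (A : set R) : set T := [set t | A (x + (1 - x) * Rt 1 t)].

(** U decides the side of the move independently of its length. *)
Lemma law_split (x : R) (A : set R) : 0 <= x <= 1 -> measurable A ->
  P (X x 1 @^-1` A) = ((p x)%:E * P (moved_left x A) +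
    (1 - p x)%:E * P (moved_right x A))%E.
Proof.
move=> x01 mA; have px := p01 x01.
pose AL : set R := [set l | A (x - x * l)]; pose AR : set R := [set r | A (x + (1 - x) * r)].
have mAL : measurable AL.
  have m : measurable_fun setT (fun l : R => x - x * l).
    by apply: measurable_funB => //; exact: measurable_funM.
  by rewrite -[AL]setTI; exact: m.
have mAR : measurable AR.
  have m : measurable_fun setT (fun r : R => x + (1 - x) * r).
    by apply: measurable_funD => //; exact: measurable_funM.
  by rewrite -[AR]setTI; exact: m.
have mI : measurable (`]-oo, p x[%classic : set R) by exact: measurable_itv.
have mJ : measurable (`[p x, +oo[%classic : set R) by exact: measurable_itv.
have E1 : P (U 1 @^-1` `]-oo, p x[%classic `&` L 1 @^-1` AL) =
    (P (U 1 @^-1` `]-oo, p x[%classic) * P (L 1 @^-1` AL))%E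
  := indep_pair (i := inr 0%N) (j := inl (inl 0%N)) erefl mI mAL.
have E2 : P (U 1 @^-1` `[p x, +oo[%classic `&` Rt 1 @^-1` AR) =
    (P (U 1 @^-1` `[p x, +oo[%classic) * P (Rt 1 @^-1` AR))%E
  := indep_pair (i := inr 0%N) (j := inl (inr 0%N)) erefl mJ mAR.
have PJ : P (U 1 @^-1` `[p x, +oo[%classic) = (1 - p x)%:E.
  rewrite -setCitvl preimage_setC probability_setC; last exact: (measurable_funPTI (U 1) mI).
  by rewrite uniform01_lt// EFinB.
have -> : X x 1 @^-1` A =
    (U 1 @^-1` `]-oo, p x[%classic `&` L 1 @^-1` AL) `|`
    (U 1 @^-1` `[p x, +oo[%classic `&` Rt 1 @^-1` AR).
  apply/seteqP; split => t; rewrite /X /= /chain_step !in_itv/= !andbT /AL /AR /=.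
    case: ltP => Up; rewrite ?mulr1 ?mulr0 ?subrr ?subr0 ?mulr0 ?addr0 => At.
      by left.
    by right; rewrite mulr1 in At.
  case=> -[Up At]; first by rewrite Up !mulr1 subrr mulr0 addr0.
  by rewrite ltNge Up /= mulr0 subr0 subr0 mulr1.
rewrite measureU//.
- congr (_ + _)%E; first by apply: (etrans E1); rewrite uniform01_lt.
  by apply: (etrans E2); rewrite PJ.
- apply: measurableI; first exact: (measurable_funPTI (U 1) mI).
  exact: (measurable_funPTI (L 1) mAL).
- apply: measurableI; first exact: (measurable_funPTI (U 1) mJ).
  exact: (measurable_funPTI (Rt 1) mAR).
- apply/seteqP; split => t //= [[+ _] [+ _]]; rewrite !in_itv/= andbT.
  by move=> /lt_le_trans/[apply]; rewrite ltxx.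
Qed.

Let q4 : R := 4^-1.

Let measurable_left (w : R) (Y : {RV P >-> R}) : measurable_fun setT (fun t => w - w * Y t).
Proof. by apply: measurable_funB => //; exact: measurable_funM. Qed.

Let left_rv (w : R) (Y : {RV P >-> R}) : {RV P >-> R} :=
  HB.pack (fun t => w - w * Y t) (isMeasurableFun.Build _ _ _ _ _ (measurable_left w Y)).

(** A power distribution function is scale free: u (1 - Y) restricted to the values
    below w is a multiple of the law of w (1 - Y).  This yields a component that is
    common to the downward moves from all u >= w. *)
Lemma beta1_self_similar (Y : {RV P >-> R}) (u w : R) (A : set R) :
  has_beta_law 1 z (distribution P Y) -> 0 < w <= u -> measurable A ->
  P (left_rv u Y @^-1` (A `&` `]-oo, w[%classic)) =
  (((w / u) `^ z)%:E * P (left_rv w Y @^-1` A))%E.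
Proof.
move=> hY /andP[w0 wu] mA.
have u0 : 0 < u by exact: lt_le_trans wu.
have mI : measurable (`]-oo, w[%classic : set R) by exact: measurable_itv.
pose m1 := mrestr (distribution P (left_rv u Y)) mI.
pose m2 := mscale (NngNum (powR_ge0 (w / u) z)) (distribution P (left_rv w Y)).
suff : m1 A = m2 A by [].
(* Equality of the two distribution functions, before taking powers. *)
have clipM y : clip (Num.min y w / u) = w / u * clip (y / w).
  have wu0 : 0 < w / u by rewrite divr_gt0.
  have wu1 : w / u <= 1 by rewrite ler_pdivrMr// mul1r.
  have yE : y / u = w / u * (y / w).
    by field; rewrite !lt0r_neq0.
  rewrite /clip minr_pMl ?invr_ge0 ?ltW// yE.
  have -> : Num.min (w / u * (y / w)) (w / u) = w / u * Num.min (y / w) 1.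
    by rewrite -{2}(mulr1 (w / u)) minr_pMr// ltW.
  set s := y / w; set r := w / u.
  have [s0|s0] := leP s 0.
    rewrite (min_l (_ : s <= 1)); last by rewrite (le_trans s0).
    rewrite (max_r (_ : r * s <= 0)); last by rewrite pmulr_rle0.
    by rewrite min_l// mulr0.
  have [s1|s1] := leP s 1.
    rewrite (max_l (_ : 0 <= r * s)); last by rewrite mulr_ge0 ?ltW.
    by rewrite min_l// mulr_ile1// ltW.
  by rewrite mulr1 (max_l (ltW wu0)) min_l.
apply: (@eq_measure_rays R m1 m2) => // [|y].
  rewrite /m1/= /mrestr.
  by rewrite (le_lt_trans (probability_le1 _ _)) ?ltry//; exact: measurableI.
rewrite /m1 /m2/= /mrestr /mscale/= /distribution/= /pushforward.
have -> : left_rv u Y @^-1` (`]-oo, y[%classic `&` `]-oo, w[%classic) =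
    [set t | u - u * Y t < Num.min y w ?<= if false].
  by apply/seteqP; split => t /=; rewrite !in_itv/= lt_min => /andP.
have -> : left_rv w Y @^-1` `]-oo, y[%classic = [set t | w - w * Y t < y ?<= if false].
  by apply/seteqP; split => t /=; rewrite !in_itv/=.
rewrite !beta1_cdf// clipM -EFinM powRM//.
- by rewrite divr_ge0 ?ltW.
- by rewrite /clip le_min ler01 le_max lexx orbT.
Qed.

Let probability_ge1 (E F : set T) : measurable E -> measurable F ->
  E `<=` F -> P E = 1%E -> P F = 1%E.
Proof.
move=> mE mF EF PE; apply/eqP; rewrite eq_le probability_le1//= -PE.
by apply: le_measure; rewrite ?inE.
Qed.

Let beta1_itv01 (Y : {RV P >-> R}) : has_beta_law 1 z (distribution P Y) ->
  P (Y @^-1` `[0, 1]%classic) = 1%E.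
Proof.
by move=> hY; rewrite (beta1_itvcc hY)// subr0 subrr powR1 powR0 ?lt0r_neq0// subr0.
Qed.

Let measurable_right (w : R) (Y : {RV P >-> R}) :
  measurable_fun setT (fun t => w + (1 - w) * Y t).
Proof. by apply: measurable_funD => //; exact: measurable_funM. Qed.

Let right_rv (w : R) (Y : {RV P >-> R}) : {RV P >-> R} :=
  HB.pack (fun t => w + (1 - w) * Y t)
    (isMeasurableFun.Build _ _ _ _ _ (measurable_right w Y)).

Lemma law_itv01 (x : R) : 0 <= x <= 1 -> P (X x 1 @^-1` `[0, 1]%classic) = 1%E.
Proof.
move=> x01; have mI : measurable (`[0, 1]%classic : set R) by exact: measurable_itv.
rewrite law_split//.
rewrite (@probability_ge1 (L 1 @^-1` `[0, 1]%classic) (moved_left x `[0, 1]%classic)).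
- rewrite (@probability_ge1 (Rt 1 @^-1` `[0, 1]%classic) (moved_right x `[0, 1]%classic)).
  + by rewrite !mule1 -EFinD addrCA subrr addr0.
  + exact: (measurable_funPTI (Rt 1) mI).
  + exact: (measurable_funPTI (right_rv x (Rt 1)) mI).
  + move=> t; rewrite /moved_right /= !in_itv/= => /andP[r0 r1].
    have : 0 <= (1 - x) * Rt 1 t by rewrite mulr_ge0; lra.
    have : 0 <= (1 - x) * (1 - Rt 1 t) by rewrite mulr_ge0; lra.
    by move=> ? ?; apply/andP; split; lra.
  + exact: beta1_itv01.
- exact: (measurable_funPTI (L 1) mI).
- exact: (measurable_funPTI (left_rv x (L 1)) mI).
- move=> t; rewrite /moved_left /= !in_itv/= => /andP[r0 r1].
  have : 0 <= x * L 1 t by rewrite mulr_ge0; lra.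
  have : 0 <= x * (1 - L 1 t) by rewrite mulr_ge0; lra.
  by move=> ? ?; apply/andP; split; lra.
- exact: beta1_itv01.
Qed.

Let p_bounds x : 0 <= x <= 1 -> c * x <= p x /\ b * (1 - x) <= 1 - p x.
Proof.
move=> /andP[x0 x1]; rewrite /p.
move: (hb) (hc) => /andP[b_gt0 b_le1] /andP[c_gt0 c_le1].
have : 0 <= (1 - b) * (1 - x) by rewrite mulr_ge0; lra.
have : 0 <= (1 - c) * x by rewrite mulr_ge0; lra.
by move=> ? ?; split; lra.
Qed.

Let law_ge_left x (A : set R) : 0 <= x <= 1 -> measurable A ->
  ((p x)%:E * P (moved_left x A) <= P (X x 1 @^-1` A))%E.
Proof.
move=> x01 mA; rewrite law_split// leeDl// mule_ge0// lee_fin.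
by have := p01 x01; lra.
Qed.

Let law_ge_right x (A : set R) : 0 <= x <= 1 -> measurable A ->
  ((1 - p x)%:E * P (moved_right x A) <= P (X x 1 @^-1` A))%E.
Proof.
move=> x01 mA; rewrite law_split// leeDr// mule_ge0// lee_fin.
by have := p01 x01; lra.
Qed.

(** For u >= 1/4 a downward move has probability p(u) >= c/4, and its landing
    point is below 1/4 with probability (1/(4 u))^z >= (1/4)^z. *)
Lemma law_minorization u (A : set R) : q4 <= u <= 1 -> measurable A ->
  ((c * q4 * q4 `^ z)%:E * P (left_rv q4 (L 1) @^-1` A) <= P (X u 1 @^-1` A))%E.
Proof.
move=> /andP[qu u1] mA; have q0 : 0 < q4 by rewrite invr_gt0.
have u0 : 0 < u by exact: lt_le_trans qu.
have u01 : 0 <= u <= 1 by rewrite (ltW u0).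
have /andP[c0 _] := hc.
have mI : measurable (`]-oo, q4[%classic : set R) by exact: measurable_itv.
apply: le_trans (law_ge_left u01 mA).
apply: (@le_trans _ _ ((c * q4)%:E * P (left_rv u (L 1) @^-1` (A `&` `]-oo, q4[%classic)))%E).
  rewrite beta1_self_similar ?q0// EFinM -muleA.
  apply: lee_wpmul2l; first by rewrite lee_fin mulr_ge0// ltW.
  apply: lee_wpmul2r => //; rewrite lee_fin.
  apply: ge0_ler_powR; rewrite ?nnegrE ?divr_ge0 ?(ltW hz) ?(ltW q0) ?(ltW u0)//.
  by rewrite ler_pdivlMr// ler_piMr// ltW.
apply: lee_pmul => //.
- by rewrite lee_fin mulr_ge0// ltW.
- rewrite lee_fin; apply: le_trans (p_bounds u01).1.
  by rewrite ler_wpM2l// ltW.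
- apply: le_measure; rewrite ?inE.
  + by apply: (measurable_funPTI (left_rv u (L 1))); exact: measurableI.
  + exact: (measurable_funPTI (left_rv u (L 1)) mA).
  + by move=> t [].
Qed.

(** From x <= 1/2 an upward move has probability at least b/2, and R >= 1/4 suffices;
    from x > 1/2 a downward move has probability at least c/2, and L <= 1/2
    suffices. *)
Lemma law_reach : exists2 delta : R, 0 < delta <= 1 &
  forall x, 0 <= x <= 1 -> (delta%:E <= P (X x 1 @^-1` `[q4, 1%R]%classic))%E.
Proof.
have h0 : 0 < 2^-1 :> R by rewrite invr_gt0.
have q0 : 0 < q4 by rewrite invr_gt0.
have qh : q4 <= 2^-1 by rewrite lef_pV2 ?posrE// ler_nat.
(* The point 1/2 is moved to exactly 1/4 when L = 1/2. *)
have hq : 2^-1 - 2^-1 * 2^-1 = q4 by rewrite /q4; field.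
have q1 : q4 < 1 by lra.
move: (hb) (hc) => /andP[b_gt0 b_le1] /andP[c_gt0 c_le1].
have mI : measurable (`[q4, 1%R]%classic : set R) by exact: measurable_itv.
pose r : R := (1 - q4) `^ z.
have r0 : 0 < r by rewrite powR_gt0// subr_gt0.
pose l : R := 1 - 2^-1 `^ z.
have l0 : 0 < l.
  have one : 1 `^ z = 1 :> R by rewrite powR1.
  by rewrite /l subr_gt0 -[ltRHS]one; apply: gt0_ltr_powR; rewrite ?nnegrE ?hz //; lra.
exists (Num.min 1 (Num.min (b * 2^-1 * r) (c * 2^-1 * l))).
  by rewrite ge_min lexx andbT !lt_min ltr01 !mulr_gt0.
move=> x x01; have [x2|x2] := leP x 2^-1.
  apply: le_trans (law_ge_right x01 mI).
  apply: (@le_trans _ _ ((b * 2^-1)%:E * P (Rt 1 @^-1` `[q4, 1%R]%classic))%E).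
    rewrite (beta1_itvcc (hR 0) (ltW q0) (ltW q1))// subrr powR0 ?lt0r_neq0// subr0.
    by rewrite -EFinM lee_fin !ge_min lexx !orbT.
  apply: lee_pmul => //.
  - by rewrite lee_fin mulr_ge0// ltW.
  - rewrite lee_fin; apply: le_trans (p_bounds x01).2.
    by rewrite ler_wpM2l//; lra.
  - apply: le_measure; rewrite ?inE.
    + exact: (measurable_funPTI (Rt 1) mI).
    + exact: (measurable_funPTI (right_rv x (Rt 1)) mI).
    + move=> t; rewrite /moved_right /= !in_itv/= => /andP[t0 t1].
      have : 0 <= (1 - x) * (1 - Rt 1 t) by rewrite mulr_ge0; lra.
      have : 0 <= x * (1 - Rt 1 t) by rewrite mulr_ge0; lra.
      by move=> ? ?; apply/andP; split; lra.
apply: le_trans (law_ge_left x01 mI).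
apply: (@le_trans _ _ ((c * 2^-1)%:E * P (L 1 @^-1` `[0%R, 2^-1%R]%classic))%E).
  rewrite (beta1_itvcc (hL 0) (lexx 0) (ltW h0)); last lra.
  rewrite subr0 powR1 (_ : 1 - 2^-1 = 2^-1 :> R); last by field.
  by rewrite -EFinM lee_fin !ge_min lexx !orbT.
apply: lee_pmul => //.
- by rewrite lee_fin mulr_ge0// ltW.
- rewrite lee_fin; apply: le_trans (p_bounds x01).1.
  by rewrite ler_wpM2l//; lra.
- apply: le_measure; rewrite ?inE.
  + by apply: (measurable_funPTI (L 1)); exact: measurable_itv.
  + exact: (measurable_funPTI (left_rv x (L 1)) mI).
  + move=> t; rewrite /moved_left /= !in_itv/= => /andP[t0 t1].
    have : 0 <= x * L 1 t by rewrite mulr_ge0; lra.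
    have : 0 <= (x - 2^-1) * (1 - L 1 t) by rewrite mulr_ge0; lra.
    by move=> ? ?; apply/andP; split; lra.
Qed.

Let Xrv x n : {RV P >-> R} :=
  HB.pack (X x n) (isMeasurableFun.Build _ _ _ _ _ (measurable_chain L Rt U mp x n)).

Let K : (R -> \bar R) -> R -> \bar R := transition L Rt U p.

(** The first move leads to [1/4, 1], the second one follows the common component
    of the downward moves from there; nu is the law of (1 - L)/4. *)
Lemma doeblin_minorization : exists eps (nu : probability R R),
  [/\ 0 < eps <= 1, nu `[0, 1]%classic = 1%E &
    forall f x, measurable_fun setT f -> (forall y, 0 <= f y)%E -> 0 <= x <= 1 ->
    (eps%:E * \int[nu]_y f y <= K (K f) x)%E].
Proof.
have [delta /andP[delta0 delta1] reach] := law_reach.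
have q0 : 0 < q4 by rewrite invr_gt0.
have q1 : q4 <= 1 by rewrite invf_le1// ler1n.
have /andP[c0 c1] := hc.
pose eta : R := c * q4 * q4 `^ z.
have eta0 : 0 < eta by rewrite !mulr_gt0// powR_gt0.
have eta1 : eta <= 1.
  rewrite !mulr_ile1 ?mulr_ge0 ?powR_ge0 ?(ltW c0) ?(ltW q0)//.
  have <- : 1 `^ z = 1 :> R by rewrite powR1.
  by apply: ge0_ler_powR; rewrite ?nnegrE ?(ltW hz) ?(ltW q0) ?ler01.
exists (delta * eta), (distribution P (left_rv q4 (L 1))); split.
- by rewrite mulr_gt0//= mulr_ile1// ltW.
- apply: (@probability_ge1 (L 1 @^-1` `[0, 1]%classic)).
  + by apply: (measurable_funPTI (L 1)); exact: measurable_itv.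
  + by apply: (measurable_funPTI (left_rv q4 (L 1))); exact: measurable_itv.
  + move=> t /=; rewrite !in_itv/= => /andP[t0 t1].
    have : 0 <= q4 * L 1 t by rewrite mulr_ge0// ltW.
    have : 0 <= q4 * (1 - L 1 t) by rewrite mulr_ge0; lra.
    by move=> ? ?; apply/andP; split; lra.
  + exact: beta1_itv01.
move=> f x mf f0 x01.
set I := (\int[_]_y f y)%E.
have I0 : (0 <= I)%E by exact: integral_ge0.
have mJ : measurable (`[q4, 1%R]%classic : set R) by exact: measurable_itv.
have step1 u : q4 <= u <= 1 -> (eta%:E * I <= K f u)%E.
  move=> u01.
  have -> : K f u = (\int[distribution P (Xrv u 1)]_y f y)%E.
    by rewrite ge0_integral_distribution.
  rewrite /I -[eta]/((NngNum (ltW eta0))%:num) -ge0_integral_mscale//.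
  apply: ge0_le_measure_integral => // A mA.
  exact: law_minorization.
have mKf : measurable_fun setT (K f) by exact: measurable_transition.
have Kf0 y : (0 <= K f y)%E by exact: transition_ge0.
have -> : K (K f) x = (\int[distribution P (Xrv x 1)]_y K f y)%E.
  by rewrite ge0_integral_distribution.
apply: (@le_trans _ _ (\int[distribution P (Xrv x 1)]_(y in `[q4, 1%R]%classic) (eta%:E * I))%E).
  rewrite (integral_cst _ mJ).
  rewrite EFinM -muleA muleC; apply: lee_wpmul2l; last exact: reach.
  by rewrite mule_ge0// lee_fin ltW.
apply: (@le_trans _ _ (\int[distribution P (Xrv x 1)]_(y in `[q4, 1%R]%classic) K f y)%E).
  apply: ge0_le_integral => //.
  - by move=> y _; rewrite mule_ge0// lee_fin ltW.
  - exact: measurable_funTS.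
by apply: ge0_subset_integral.
Qed.

Lemma law_ray x y : 0 < x < 1 ->
  P (X x 1 @^-1` `]-oo, y[%classic) =
  (p x * clip (y / x) `^ z + (1 - p x) * (1 - clip ((1 - y) / (1 - x)) `^ z))%:E.
Proof.
move=> /andP[x0 x1]; have x01 : 0 <= x <= 1 by rewrite !ltW.
have mI : measurable (`]-oo, y[%classic : set R) by exact: measurable_itv.
rewrite law_split// [RHS]EFinD !EFinM; congr (_ + _)%E; congr (_ * _)%E.
  rewrite -(beta1_cdf y false (hL 0) x0).
  have -> // : moved_left x `]-oo, y[%classic = [set t | x - x * L 1 t < y ?<= if false].
  by apply/seteqP; split => t; rewrite /moved_left /= in_itv.
have y1 : 0 < 1 - x by rewrite subr_gt0.
rewrite EFinB -(beta1_cdf (1 - y) true (hR 0) y1).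
have -> : [set t | 1 - x - (1 - x) * Rt 1 t < 1 - y ?<= if true] =
    ~` moved_right x `]-oo, y[%classic.
  apply/seteqP; split => t; rewrite /moved_right /= in_itv/=.
    by move=> H; apply/negP; rewrite -leNgt; lra.
  by move=> /negP; rewrite -leNgt; lra.
have mr : measurable (moved_right x `]-oo, y[%classic).
  exact: (measurable_funPTI (right_rv x (Rt 1)) mI).
have fr : P (moved_right x `]-oo, y[%classic) \is a fin_num by exact: fin_num_measure.
by rewrite probability_setC// -(fineK fr) -!EFinB subKr.
Qed.

(** * Stationarity of the beta law *)

Section stationarity.
Variable Pi : probability (measurableTypeR R) R.
Hypothesis PiE : has_beta_law (b * z) (c * z) Pi.

Let bz0 : 0 < b * z. Proof. by rewrite mulr_gt0//; case/andP: hb. Qed.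
Let cz0 : 0 < c * z. Proof. by rewrite mulr_gt0//; case/andP: hc. Qed.
Let B : R := betaR_fun (b * z) (c * z).
Let B0 : 0 < B. Proof. exact: betaR_fun_gt0. Qed.

(** The mass that one step carries across the level y, in either direction, under
    the beta law. *)
Let flux (y : R) : R := y `^ (b * z) * (1 - y) `^ (c * z) / (z * B).


Let mpowR (a : R) : measurable_fun setT (fun x : R => x `^ a).
Proof. exact: measurable_powR. Qed.

Let m1powR (a : R) : measurable_fun setT (fun x : R => (1 - x) `^ a).
Proof. by apply: (measurableT_comp (mpowR a)); exact: measurable_funB. Qed.

(** On [0, 1] the absolute value is p itself; it makes the integrand nonnegative on
    the whole line. *)
Lemma flux_down y : 0 < y < 1 ->
  (\int[Pi]_(x in `[y, 1%R[%classic) (`|p x| * (y `^ z * x `^ (- z)))%:E = (flux y)%:E)%E.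
Proof.
move=> y01.
rewrite (ge0_integral_beta_law PiE); last 3 first.
- exact: measurable_itv.
- apply/measurable_EFinP; apply: measurable_funM; first exact: measurableT_comp.
  by apply: measurable_funM.
- by move=> x; rewrite lee_fin !mulr_ge0 ?powR_ge0.
have -> : (`[y, 1%R[ `&` `]0%R, 1%R[ = `[y, 1[ :> set R)%classic.
  by apply/seteqP; split => x /=; rewrite !in_itv/=; lra.
pose g (x : R) : R := y `^ z / (z * B) * (x `^ (- ((1 - b) * z) - 1) *
  (1 - x) `^ (c * z - 1) * (c * z * x - - ((1 - b) * z) * (1 - x))).
have mg : measurable_fun setT (fun x => (g x)%:E : \bar R).
  apply/measurable_EFinP; apply: measurable_funM => //.
  apply: measurable_funM; first by apply: measurable_funM => //; exact: m1powR.
  apply: measurable_funB; apply: measurable_funM => //.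
  exact: measurable_funB.
transitivity (\int[@lebesgue_measure R]_(x in `[y, 1%R[) (g x)%:E)%E.
  apply: eq_integral => x; rewrite inE/= in_itv/= => yx1; rewrite -EFinM; congr EFin.
  have x01 : 0 <= x <= 1 by lra.
  have x0 : x != 0 by apply: lt0r_neq0; lra.
  rewrite ger0_norm; last by have := p01 x01; lra.
  rewrite /beta_weight -/B /g /p.
  have -> : x `^ (- ((1 - b) * z) - 1) = x `^ (- z) * x `^ (b * z - 1).
    rewrite -powRD ?x0 ?implybT//; congr (_ `^ _); ring.
  have zn0 : z != 0 by exact: lt0r_neq0.
  have Bn0 : B != 0 by exact: lt0r_neq0.
  by field; apply/andP.
rewrite -integral_itv_obnd_cbnd; last exact: measurable_funTS.
have aN : - ((1 - b) * z) <= 0.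
  by rewrite oppr_le0 mulr_ge0// ?(ltW hz)// subr_ge0; case/andP: hb.
have := integral_beta_primitive_right aN cz0 y01.
rewrite /g; under [in X in _ -> X]eq_integral do rewrite EFinM.
rewrite ge0_integralZl//; last 3 first.
- apply/measurable_EFinP/measurable_funTS.
  apply: measurable_funM; first by apply: measurable_funM => //; exact: m1powR.
  apply: measurable_funB; apply: measurable_funM => //.
  exact: measurable_funB.
- move=> x; rewrite /= in_itv/= => yx1; rewrite lee_fin mulr_ge0 ?mulr_ge0 ?powR_ge0//.
  rewrite subr_ge0; apply: (@le_trans _ _ 0).
    by rewrite mulr_le0_ge0//; lra.
  by rewrite mulr_ge0 ?(ltW cz0)//; lra.
- by rewrite lee_fin divr_ge0 ?powR_ge0// mulr_ge0 ?ltW.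
move=> ->; rewrite -EFinM; congr EFin; rewrite /flux.
have -> : y `^ (b * z) = y `^ z * y `^ (- ((1 - b) * z)).
  have y0 : y != 0 by apply: lt0r_neq0; lra.
  rewrite -powRD ?y0 ?implybT//; congr (_ `^ _); ring.
ring.
Qed.

Lemma flux_up y : 0 < y < 1 ->
  (\int[Pi]_(x in `]0%R, y[%classic) (`|1 - p x| * ((1 - y) `^ z * (1 - x) `^ (- z)))%:E =
   (flux y)%:E)%E.
Proof.
move=> y01.
rewrite (ge0_integral_beta_law PiE); last 3 first.
- exact: measurable_itv.
- apply/measurable_EFinP; apply: measurable_funM.
    by apply: measurableT_comp => //; exact: measurable_funB.
  by apply: measurable_funM => //; exact: m1powR.
- by move=> x; rewrite lee_fin !mulr_ge0 ?powR_ge0.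
have -> : (`]0%R, y[ `&` `]0%R, 1%R[ = `]0, y[ :> set R)%classic.
  by apply/seteqP; split => x /=; rewrite !in_itv/=; lra.
pose g (x : R) : R := (1 - y) `^ z / (z * B) * (x `^ (b * z - 1) *
  (1 - x) `^ (- ((1 - c) * z) - 1) * (b * z * (1 - x) - - ((1 - c) * z) * x)).
transitivity (\int[@lebesgue_measure R]_(x in `]0%R, y[) (g x)%:E)%E.
  apply: eq_integral => x; rewrite inE/= in_itv/= => yx1; rewrite -EFinM; congr EFin.
  have x01 : 0 <= x <= 1 by lra.
  have x0 : 1 - x != 0 by apply: lt0r_neq0; lra.
  rewrite ger0_norm; last by have := p01 x01; lra.
  rewrite /beta_weight -/B /g /p.
  have -> : (1 - x) `^ (- ((1 - c) * z) - 1) = (1 - x) `^ (- z) * (1 - x) `^ (c * z - 1).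
    rewrite -powRD ?x0 ?implybT//; congr (_ `^ _); ring.
  have zn0 : z != 0 by exact: lt0r_neq0.
  have Bn0 : B != 0 by exact: lt0r_neq0.
  by field; apply/andP.
have aN : - ((1 - c) * z) <= 0.
  by rewrite oppr_le0 mulr_ge0// ?(ltW hz)// subr_ge0; case/andP: hc.
have := integral_beta_primitive_left bz0 aN y01.
rewrite /g; under [in X in _ -> X]eq_integral do rewrite EFinM.
rewrite ge0_integralZl//; last 3 first.
- apply/measurable_EFinP/measurable_funTS.
  apply: measurable_funM; first by apply: measurable_funM => //; exact: m1powR.
  apply: measurable_funB; apply: measurable_funM => //.
  exact: measurable_funB.
- move=> x; rewrite /= in_itv/= => yx1; rewrite lee_fin mulr_ge0 ?mulr_ge0 ?powR_ge0//.
  rewrite subr_ge0; apply: (@le_trans _ _ 0).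
    by rewrite mulr_le0_ge0//; lra.
  by rewrite mulr_ge0 ?(ltW bz0)//; lra.
- by rewrite lee_fin divr_ge0 ?powR_ge0// mulr_ge0 ?ltW.
move=> ->; rewrite -EFinM; congr EFin; rewrite /flux.
have -> : (1 - y) `^ (c * z) = (1 - y) `^ z * (1 - y) `^ (- ((1 - c) * z)).
  have y0 : 1 - y != 0 by apply: lt0r_neq0; lra.
  rewrite -powRD ?y0 ?implybT//; congr (_ `^ _); ring.
ring.
Qed.

Let clip_ge1 (s : R) : 1 <= s -> clip s `^ z = 1.
Proof. by move=> s1; rewrite /clip max_l ?(le_trans ler01)// min_r// powR1. Qed.

Let clip_le0 (s : R) : s <= 0 -> clip s `^ z = 0.
Proof. by move=> s0; rewrite /clip max_r// min_l// powR0// lt0r_neq0. Qed.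

Let clip01 (s : R) : 0 <= s <= 1 -> clip s = s.
Proof. by case/andP=> s0 s1; rewrite /clip max_l// min_l. Qed.

Let Pi_oo : Pi `]0, 1[%classic = 1%E.
Proof. exact: beta_law_itv01 PiE. Qed.

Let Pi_restrict (A : set (measurableTypeR R)) : measurable A ->
  Pi A = Pi (A `&` `]0, 1[%classic).
Proof.
move=> mA; rewrite !PiE//; last by apply: measurableI => //; exact: measurable_itv.
by rewrite !betaR_pdf_restrict -setIA setIid.
Qed.

Let powR_div (u v : R) : 0 <= u -> 0 < v -> (u / v) `^ z = u `^ z * v `^ (- z).
Proof.
move=> u0 v0; rewrite powRM ?invr_ge0 ?(ltW v0)//; congr (_ * _).
by rewrite -powR_inv1 ?(ltW v0)// -powRrM mulN1r.
Qed.

Let G (y x : R) : \bar R := law_at P X x 1 `]-oo, y[%classic.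

Let GE y x : 0 < x < 1 -> G y x =
  (p x * clip (y / x) `^ z + (1 - p x) * (1 - clip ((1 - y) / (1 - x)) `^ z))%:E.
Proof. exact: law_ray. Qed.

Let G_ge y x : 0 < y -> y <= x < 1 -> G y x = (`|p x| * (y `^ z * x `^ (- z)))%:E.
Proof.
move=> y0 /andP[yx x1]; have x0 : 0 < x by exact: lt_le_trans yx.
have x1' : 0 < 1 - x by rewrite subr_gt0.
rewrite GE ?x0// (@clip_ge1 ((1 - y) / (1 - x))); last by rewrite ler_pdivlMr//; lra.
rewrite subrr mulr0 addr0 clip01; last first.
  by rewrite divr_ge0 ?(ltW x0) ?(ltW y0)// ler_pdivrMr// mul1r.
rewrite powR_div ?(ltW y0)// ger0_norm//.
have : 0 <= x <= 1 by rewrite !ltW.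
by move/p01 => /andP[].
Qed.

Let G_lt y x : y < 1 -> 0 < x < y ->
  (G y x + (`|1 - p x| * ((1 - y) `^ z * (1 - x) `^ (- z)))%:E = 1)%E.
Proof.
move=> y1 /andP[x0 xy]; have x1 : x < 1 by exact: lt_trans xy y1.
have x1' : 0 < 1 - x by rewrite subr_gt0.
have y1' : 0 < 1 - y by rewrite subr_gt0.
rewrite GE ?x0// clip_ge1; last by rewrite ler_pdivlMr// mul1r ltW.
rewrite clip01; last first.
  by rewrite divr_ge0 ?(ltW x1') ?(ltW y1')// ler_pdivrMr// mul1r lerB// ltW.
rewrite powR_div ?(ltW y1')// ger0_norm; last first.
  have : 0 <= x <= 1 by rewrite !ltW.
  by move/p01 => /andP[_]; rewrite subr_ge0.
by rewrite -EFinD; congr EFin; ring.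
Qed.

(** For 0 < y < 1 the mass below y loses the upward flux through y and gains the
    downward one, and these are equal. *)
Lemma beta_stationary : stationary01 P X Pi.
Proof.
have moo : measurable (`]0, 1[%classic : set (measurableTypeR R)) by exact: measurable_itv.
have mcc : measurable (`[0, 1]%classic : set (measurableTypeR R)) by exact: measurable_itv.
have Pi_cc : Pi `[0, 1]%classic = 1%E.
  rewrite Pi_restrict// setIidr// => x /=; rewrite !in_itv/= => /andP[x0 x1].
  by rewrite !ltW.
apply: (stationary01_rays mp Pi_cc) => y.
have mray : measurable (`]-oo, y[%classic : set (measurableTypeR R)) by exact: measurable_itv.
have mG : measurable_fun setT (G y).
  exact: (measurable_law L Rt U mp (measurable_itv `]-oo, y[)).
have G0 x : (0 <= G y x)%E by [].
rewrite -/X -/(G y).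
transitivity (\int[Pi]_(x in `]0%R, 1%R[%classic) G y x)%E.
  by rewrite -(integral_carrier mcc Pi_cc mG G0) (integral_carrier moo Pi_oo mG G0).
rewrite Pi_restrict//.
have [y0|y0] := leP y 0.
  rewrite (_ : _ `&` _ = set0); last first.
    apply/seteqP; split => x //=; rewrite !in_itv/= => -[xy /andP[x0 _]].
    by move: (lt_le_trans xy y0); rewrite ltNge (ltW x0).
  rewrite measure0 integral0_eq// => x; rewrite /= in_itv/= => /andP[x0 x1].
  have x1' : 0 < 1 - x by rewrite subr_gt0.
  rewrite GE ?x0// clip_le0; last by rewrite pmulr_lle0 ?invr_gt0.
  rewrite clip_ge1; last by rewrite ler_pdivlMr//; lra.
  by rewrite subrr !mulr0 addr0.
have [y1|y1] := leP 1 y.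
  rewrite setIidr; last first.
    move=> x /=; rewrite !in_itv/= => /andP[_ x1]; exact: lt_le_trans y1.
  rewrite -[RHS]mul1e -integral_cst//; apply: eq_integral => x.
  rewrite inE/= in_itv/= => /andP[x0 x1].
  have x1' : 0 < 1 - x by rewrite subr_gt0.
  rewrite GE ?x0// clip_ge1; last by rewrite ler_pdivlMr// mul1r (le_trans (ltW x1)).
  rewrite clip_le0; last by rewrite pmulr_lle0 ?invr_gt0// subr_le0.
  by congr EFin; ring.
have y01 : 0 < y < 1 by rewrite y0.
have mlow : measurable (`]0, y[%classic : set (measurableTypeR R)) by exact: measurable_itv.
have mupp : measurable (`[y, 1[%classic : set (measurableTypeR R)) by exact: measurable_itv.
have -> : `]-oo, y[%classic `&` `]0, 1[%classic = `]0, y[%classic :> set R.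
  by apply/seteqP; split => x /=; rewrite !in_itv/=; lra.
have -> : `]0, 1[%classic = `]0, y[%classic `|` `[y, 1[%classic :> set R.
  apply/seteqP; split => x /=; rewrite !in_itv/=; last by case; lra.
  by move=> /andP[x0 x1]; case: (ltP x y) => xy; [left; rewrite x0|right].
rewrite ge0_integral_setU//; last 2 first.
- exact: measurable_funTS.
- apply/disj_set2P/seteqP; split => x //=; rewrite !in_itv/= => -[/andP[_ xy] /andP[yx _]].
  by move: (lt_le_trans xy yx); rewrite ltxx.
have -> : (\int[Pi]_(x in `[y, 1%R[%classic) G y x = (flux y)%:E)%E.
  rewrite -flux_down//; apply: eq_integral => x; rewrite inE/= in_itv/=.
  exact: G_ge.
(* The downward flux is replaced by the upward one, which completes the
   integral over ]0, y[ to that of the constant 1. *)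
rewrite -(flux_up y01) -ge0_integralD//.
- rewrite -[RHS]mul1e -integral_cst//; apply: eq_integral => x.
  by rewrite inE/= in_itv/=; exact: G_lt.
- exact: measurable_funTS.
- by move=> x _; rewrite lee_fin !mulr_ge0 ?powR_ge0.
- apply/measurable_EFinP/measurable_funTS; apply: measurable_funM.
    by apply: measurableT_comp => //; exact: measurable_funB.
  by apply: measurable_funM => //; exact: m1powR.
Qed.

End stationarity.
End kernel.

(** * Conclusion *)

Theorem mainTheorem3 (R : realType) (z b c : R)
  (hz : 0 < z) (hb : 0 < b <= 1) (hc : 0 < c <= 1)
  (d : measure_display) (T : measurableType d) (P : probability T R)
  (L Rt U : nat -> {RV P >-> R})
  (hL : forall n : nat, has_beta_law 1 z (distribution P (L n.+1)))
  (hR : forall n : nat, has_beta_law 1 z (distribution P (Rt n.+1)))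
  (hU : forall n : nat, has_uniform01_law (distribution P (U n.+1)))
  (hind : mutually_independent P (noise_family L Rt U)) :
  exists Pi : probability (measurableTypeR R) R,
    has_beta_law (b * z) (c * z) Pi /\
    ergodic01_with P
      (chain (fun x : R => c * x + (1 - b) * (1 - x)) L Rt U) Pi.
Proof.
have bz0 : 0 < b * z by rewrite mulr_gt0//; case/andP: hb.
have cz0 : 0 < c * z by rewrite mulr_gt0//; case/andP: hc.
have [Pi PiE] := exists_beta_law bz0 cz0.
exists Pi; split; first exact: PiE.
have mp : measurable_fun setT (fun x : R => c * x + (1 - b) * (1 - x)).
  by apply: measurable_funD; apply: measurable_funM => //; exact: measurable_funB.
have idL n (A : set R) : measurable A ->
    distribution P (L n.+1) A = distribution P (L 1%N) A.
  by move=> mA; rewrite (hL n A mA) (hL 0%N A mA).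
have idR n (A : set R) : measurable A ->
    distribution P (Rt n.+1) A = distribution P (Rt 1%N) A.
  by move=> mA; rewrite (hR n A mA) (hR 0%N A mA).
have idU n (A : set R) : measurable A ->
    distribution P (U n.+1) A = distribution P (U 1%N) A.
  by move=> mA; rewrite (hU n A mA) (hU 0%N A mA).
have [eps [nu [eps01 nu01 minor]]] :=
  doeblin_minorization hz hb hc hL hR hU hind.
apply: (doeblin_ergodic mp hind idL idR idU _ eps01 nu01 minor).
  by move=> x; exact: (law_itv01 hz hb hc hL hR hU hind).
exact: (beta_stationary hz hb hc hL hR hU hind PiE).
Qed.
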